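(* Let $\mathcal{D}$ be a set of discounting functions and let $\mathcal{F}\subseteq\mathcal{F}_{\mathrm{mc}}$ be a set of monotone and continuous propositional quality operators. Then the near-optimal scheduling problem for $\mathrm{LTL}^{\mathrm{disc}}[\mathcal{D},\mathcal{F}]$ is decidable: there is an algorithm that, given a Kripke structure $\mathcal{K}$, a formula $\varphi$ of $\mathrm{LTL}^{\mathrm{disc}}[\mathcal{D},\mathcal{F}]$ and a real number $\varepsilon\in(0,1)$, finds a path $\xi_0\in\mathrm{path}(\mathcal{K})$ with $[\![\xi_0,\varphi]\!]\ge \sup_{\xi\in\mathrm{path}(\mathcal{K})}[\![\xi,\varphi]\!]-\varepsilon$.
   Context: Fix a finite set $AP$ of atomic propositions. A computation is an infinite sequence $\pi=\pi_0\pi_1\ldots\in(\mathcal{P}(AP))^\omega$; $\pi^i=\pi_i\pi_{i+1}\ldots$ denotes its suffix. A discounting function is a strictly decreasing $\eta:\mathbb{N}\to[0,1]$ with $\lim_{i\to\infty}\eta(i)=0$. A $k$-ary propositional quality operator is a function $f:[0,1]^k\to[0,1]$; $\mathcal{F}_{\mathrm{mc}}$ is the set of those that are monotone (w.r.t. the componentwise order) and continuous (w.r.t. the Euclidean topology). For a set $\mathcal{D}$ of discounting functions and a set $\mathcal{F}$ of propositional quality operators, formulas of $\mathrm{LTL}^{\mathrm{disc}}[\mathcal{D},\mathcal{F}]$ are given by $\varphi::=\mathtt{True}\mid p\mid\neg\varphi\mid\varphi\wedge\varphi\mid \mathsf{X}\varphi\mid\varphi\,\mathsf{U}\,\varphi\mid\varphi\,\mathsf{U}_\eta\,\varphi\mid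 f(\varphi,\ldots,\varphi)$ with $p\in AP$, $\eta\in\mathcal{D}$, $f\in\mathcal{F}$ of suitable arity. The truth value $[\![\pi,\varphi]\!]\in[0,1]$ is: $[\![\pi,\mathtt{True}]\!]=1$; $[\![\pi,p]\!]=1$ if $p\in\pi_0$ and $0$ otherwise; $[\![\pi,\neg\varphi]\!]=1-[\![\pi,\varphi]\!]$; $[\![\pi,\varphi_1\wedge\varphi_2]\!]=\min\{[\![\pi,\varphi_1]\!],[\![\pi,\varphi_2]\!]\}$; $[\![\pi,\mathsf{X}\varphi]\!]=[\![\pi^1,\varphi]\!]$; $[\![\pi,\varphi_1\mathsf{U}\varphi_2]\!]=\sup_{i\in\mathbb{N}}\min\{[\![\pi^i,\varphi_2]\!],\min_{0\le j<i}[\![\pi^j,\varphi_1]\!]\}$; $[\![\pi,\varphi_1\mathsf{U}_\eta\varphi_2]\!]=\sup_{i\in\mathbb{N}}\min\{\eta(i)[\![\pi^i,\varphi_2]\!],\min_{0\le j<i}\eta(j)[\![\pi^j,\varphi_1]\!]\}$; $[\![\pi,f(\varphi_1,\ldots,\varphi_k)]\!]=f([\![\pi,\varphi_1]\!],\ldots,[\![\pi,\varphi_k]\!])$. A Kripke structure is $\mathcal{K}=(W,R,\lambda)$ with $W$ finite, $R\subseteq W^2$ left-total, and $\lambda:W\to\mathcal{P}(AP)$; a path is $\xi=s_0s_1\ldots\in W^\omega$ with $(s_i,s_{i+1})\in R$ for all $i$; $\mathrm{path}(\mathcal{K})$ is the set of paths; $\lambda(\xi)=\lambda(s_0)\lambda(s_1)\ldots$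 and $[\![\xi,\varphi]\!]=[\![\lambda(\xi),\varphi]\!]$. The near-optimal scheduling problem: given $\mathcal{K}$, $\varphi$ and $\varepsilon\in(0,1)$, find $\xi_0\in\mathrm{path}(\mathcal{K})$ with $[\![\xi_0,\varphi]\!]\ge\sup_{\xi\in\mathrm{path}(\mathcal{K})}[\![\xi,\varphi]\!]-\varepsilon$. *)

(* Defs.v *)
From Stdlib Require Cantor.
From HB Require Import structures.
From mathcomp Require Import all_boot all_order all_algebra.
From mathcomp Require Import all_classical all_reals all_analysis.
Set Implicit Arguments. Unset Strict Implicit. Unset Printing Implicit Defensive.
Import Order.TTheory GRing.Theory Num.Theory numFieldNormedType.Exports.
Local Open Scope classical_set_scope.
Local Open Scope ring_scope.

Definition discounting (R : realType) (eta : nat -> R) : Prop :=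
  [/\ forall i, 0 <= eta i <= 1,
      forall i j, (i < j)%N -> eta j < eta i
    & eta @ \oo --> (0 : R)].

Definition unit_cube (R : realType) k : set 'rV[R]_k :=
  [set x | forall i, 0 <= x ord0 i <= 1].

(* A k-ary propositional quality operator [0,1]^k -> [0,1] is a function on
   'rV[R]_k of which only the restriction to the unit cube matters; the
   topology of 'rV[R]_k is the product (hence the Euclidean) topology. *)
Definition quality_operator (R : realType) k (f : 'rV[R]_k -> R) : Prop :=
  forall x, unit_cube x -> 0 <= f x <= 1.

Definition monotone_operator (R : realType) k (f : 'rV[R]_k -> R) : Prop :=
  forall x y, unit_cube x -> unit_cube y ->
    (forall i, x ord0 i <= y ord0 i) -> f x <= f y.

Definition Fmc (R : realType) k : set ('rV[R]_k -> R) :=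
  [set f | [/\ quality_operator f, monotone_operator f
             & {within @unit_cube R k, continuous f}]].

Section Logic.
Variables (R : realType) (AP : finType).
Variables (D : set (nat -> R)) (F : forall k, set ('rV[R]_k -> R)).

Inductive formula : Type :=
| FTrue
| FAtom of AP
| FNot of formula
| FAnd of formula & formula
| FNext of formula
| FUntil of formula & formula
| FDUntil (eta : nat -> R) of D eta & formula & formula
| FOp k (f : 'rV[R]_k -> R) of F f & ('I_k -> formula).

Definition computation := nat -> {set AP}.

Definition suffix_at (pi : computation) (i : nat) : computation :=
  fun j => pi (i + j)%N.

(* The neutral element 1 is the value of the minimum over no j, when i = 0. *)
Fixpoint truth (pi : computation) (phi : formula) {struct phi} : R :=
  match phi with
  | FTrue => 1
  | FAtom p => (p \in pi 0%N)%:R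
  | FNot phi1 => 1 - truth pi phi1
  | FAnd phi1 phi2 => Num.min (truth pi phi1) (truth pi phi2)
  | FNext phi1 => truth (suffix_at pi 1) phi1
  | FUntil phi1 phi2 =>
      sup (range (fun i : nat =>
        Num.min (truth (suffix_at pi i) phi2)
                (\big[Num.min/1]_(j < i) truth (suffix_at pi j) phi1)))
  | FDUntil eta _ phi1 phi2 =>
      sup (range (fun i : nat =>
        Num.min (eta i * truth (suffix_at pi i) phi2)
                (\big[Num.min/1]_(j < i)
                   (eta j * truth (suffix_at pi j) phi1))))
  | FOp k f _ args => f (\row_(i < k) truth pi (args i))
  end.

End Logic.

Arguments FTrue {R AP D F}.

(* The state set is nonempty, so that there is a path to be found. *)
Record kripke (AP : finType) := Kripke {
  state : finType;
  trans : rel state;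
  label : state -> {set AP};
  state_nonempty : (0 < #|state|)%N;
  trans_total : forall s, exists t, trans s t }.

Section Paths.
Variables (AP : finType) (K : kripke AP).

Definition is_path : set (nat -> state K) :=
  [set xi | forall i, trans (xi i) (xi i.+1)].

Definition trace (xi : nat -> state K) : computation AP :=
  fun i => label (xi i).

(* The ultimately periodic sequence u (s v)^omega. *)
Definition lasso (u : seq (state K)) (s : state K) (v : seq (state K)) :
    nat -> state K :=
  fun i => if (i < size u)%N then nth s u i
           else nth s (s :: v) ((i - size u) %% (size v).+1).

Definition near_optimal (R : realType) (D : set (nat -> R))
    (F : forall k, set ('rV[R]_k -> R)) (phi : formula AP D F) (eps : R)
    (xi0 : nat -> state K) : Prop :=
  is_path xi0 /\
  sup [set truth (trace xi) phi | xi in is_path] - eps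
    <= truth (trace xi0) phi.

End Paths.

(* Partial recursive functions relative to an oracle O : nat -> nat, presented
   as unary functions on nat with Cantor's pairing: run O p x y states that
   program p, on input x and with oracle O, halts with output y. *)
Definition pair_code (a b : nat) : nat := Cantor.to_nat (a, b).

Definition seq_code (s : seq nat) : nat :=
  foldr (fun a c => (pair_code a c).+1) 0%N s.

Inductive program : Type :=
| PZero
| PSucc
| PFst
| PSnd
| POracle
| PPair of program & program
| PComp of program & program
| PRec of program & program
| PMu of program.

Inductive run (O : nat -> nat) : program -> nat -> nat -> Prop :=
| run_zero x : run O PZero x 0
| run_succ x : run O PSucc x x.+1
| run_fst a b : run O PFst (pair_code a b) a
| run_snd a b : run O PSnd (pair_code a b) b
| run_oracle x : run O POracle x (O x)
| run_pair p q x a b :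
    run O p x a -> run O q x b -> run O (PPair p q) x (pair_code a b)
| run_comp p q x y z :
    run O q x y -> run O p y z -> run O (PComp p q) x z
| run_rec0 p q a y :
    run O p a y -> run O (PRec p q) (pair_code a 0) y
| run_recS p q a n y z :
    run O (PRec p q) (pair_code a n) y ->
    run O q (pair_code a (pair_code n y)) z ->
    run O (PRec p q) (pair_code a n.+1) z
| run_mu p a n (w : nat -> nat) :
    (forall i, (i < n)%N -> run O p (pair_code a i) (w i).+1) ->
    run O p (pair_code a n) 0 ->
    run O (PMu p) a n.

Lemma pair_code_inj a b a' b' :
  pair_code a b = pair_code a' b' -> a = a' /\ b = b'.
Proof.
move=> /(congr1 Cantor.of_nat); rewrite !Cantor.cancel_of_to.
by case=> -> ->.
Qed.

Lemma run_det O p x y z : run O p x y -> run O p x z -> y = z.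
Proof.
move=> H; elim: H z => {p x y} [x|x|a b|a b|x|p q x a b _ IHp _ IHq
  |p q x y z _ IHq _ IHp|p q a y _ IH|p q a n y z _ IH1 _ IH2
  |p a n w _ IHlt _ IH0] r.
- by move=> H; inversion H.
- by move=> H; inversion H.
- move Ex: (pair_code a b) => x H; inversion H; subst.
  by match goal with E : pair_code _ _ = pair_code _ _ |- _ =>
    case: (pair_code_inj E) end.
- move Ex: (pair_code a b) => x H; inversion H; subst.
  by match goal with E : pair_code _ _ = pair_code _ _ |- _ =>
    case: (pair_code_inj E) end.
- by move=> H; inversion H.
- move=> H; inversion H as [| | | | |? ? ? a' b' Ha Hb| | | |]; subst.
  by rewrite (IHp _ Ha) (IHq _ Hb).
- move=> H; inversion H as [| | | | | |? ? ? y' ? Hq Hp| | |]; subst.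
  by rewrite -(IHq _ Hq) in Hp; exact: IHp.
- move Ex: (pair_code a 0) => x H.
  inversion H as [| | | | | | |? ? a' ? Hp|? ? a' n' y' ? H1 H2|]; subst;
  match goal with E : pair_code _ _ = pair_code _ _ |- _ =>
    case: (pair_code_inj E) => // ? ? end; subst.
  exact: IH.
- move Ex: (pair_code a n.+1) => x H.
  inversion H as [| | | | | | |? ? a' ? Hp|? ? a' n' y' ? H1 H2|]; subst;
  match goal with E : pair_code _ _ = pair_code _ _ |- _ =>
    case: (pair_code_inj E) => // ? [?] end; subst.
  by rewrite -(IH1 _ H1) in H2; exact: IH2.
- move=> H; inversion H as [| | | | | | | | |? ? ? w' Hlt Hz]; subst.
  case: (ltngtP n r) => // lt_nr; first by have := IH0 _ (Hlt _ lt_nr).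
  by have := IHlt _ lt_nr _ Hz.
Qed.

(* Names: real-valued data is accessible to a program through an oracle that
   returns dyadic approximations of any requested precision. *)
Definition dyadic (R : realType) (m n : nat) : R := m%:R / 2 ^+ n.
Arguments dyadic : clear implicits.

Definition names_real (R : realType) (nu : nat -> nat) (x : R) : Prop :=
  forall n, `|dyadic R (nu n) n - x| <= (2 ^+ n)^-1.

Definition names_discounting (R : realType) (nu : nat -> nat)
    (eta : nat -> R) : Prop :=
  forall i, names_real (fun n => nu (pair_code i n)) (eta i).

(* An operator is queried at points of the cube with dyadic coordinates. *)
Definition names_operator (R : realType) k (nu : nat -> nat)
    (f : 'rV[R]_k -> R) : Prop :=
  forall (l : nat) (m : 'I_k -> nat), (forall i, (m i <= 2 ^ l)%N) ->
    names_real
      (fun n => nu (pair_code (pair_code l (seq_code (codom m))) n))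
      (f (\row_(i < k) dyadic R (m i) l)).

(* The c-th of countably many functions packed into one oracle. *)
Definition channel (O : nat -> nat) (c : nat) : nat -> nat :=
  fun x => O (pair_code c x).

(* codes_formula O phi n: n is a code of the syntax tree of phi in which each
   discounting function and each operator is replaced by the number of a
   channel of O that names it. *)
Fixpoint codes_formula (R : realType) (AP : finType) (D : set (nat -> R))
    (F : forall k, set ('rV[R]_k -> R)) (O : nat -> nat)
    (phi : formula AP D F) (n : nat) {struct phi} : Prop :=
  match phi with
  | FTrue => n = seq_code [:: 0%N]
  | FAtom p => n = seq_code [:: 1%N; nat_of_ord (enum_rank p)]
  | FNot phi1 =>
      exists2 a, codes_formula O phi1 a & n = seq_code [:: 2%N; a]
  | FAnd phi1 phi2 => exists a b,
      [/\ codes_formula O phi1 a, codes_formula O phi2 b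
        & n = seq_code [:: 3%N; a; b]]
  | FNext phi1 =>
      exists2 a, codes_formula O phi1 a & n = seq_code [:: 4%N; a]
  | FUntil phi1 phi2 => exists a b,
      [/\ codes_formula O phi1 a, codes_formula O phi2 b
        & n = seq_code [:: 5%N; a; b]]
  | FDUntil eta _ phi1 phi2 => exists c a b,
      [/\ names_discounting (channel O c) eta,
          codes_formula O phi1 a, codes_formula O phi2 b
        & n = seq_code [:: 6%N; c; a; b]]
  | FOp k f _ args => exists c (a : 'I_k -> nat),
      [/\ names_operator (channel O c) f,
          forall i, codes_formula O (args i) (a i)
        & n = seq_code [:: 7%N, c & codom a]]
  end.

Definition states_code (AP : finType) (K : kripke AP) (u : seq (state K)) :
    nat :=
  seq_code [seq nat_of_ord (enum_rank s) | s <- u].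

(* States and atomic propositions are numbered by enum_rank; the code lists,
   for each state, its successors and its label. *)
Definition kripke_code (AP : finType) (K : kripke AP) : nat :=
  seq_code
    [seq pair_code
           (states_code [seq t <- enum (state K) | trans s t])
           (seq_code [seq nat_of_ord (enum_rank p) | p <- enum (label s)])
    | s <- enum (state K)].

(* Main.v *)
(* At precision n all truth values are enclosed between two multiples of 2^-n:
   operators are queried at grid points (monotonicity makes the enclosure sound,
   uniform continuity on the cube makes it tight) and discounted until is cut off
   at horizon n. The resulting finite-valued semantics looks n + 1 positions ahead
   except for undiscounted until, which is determined by its one-step equation
   together with the fulfilment of its promises. Hence pumping on finitely many
   types of positions turns every path into a lasso of computably bounded size
   with the same enclosure at its first position. The program searches for a
   precision n and a lasso whose lower bound is within eps of the upper bounds of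
   all lassos of that size; since the enclosures shrink uniformly over all paths,
   the search succeeds. *)
Require Import Defs.
From mathcomp Require Import all_boot all_order all_algebra.
From mathcomp Require Import all_classical all_reals all_analysis.
From mathcomp Require Import zify ring lra.
Import Order.TTheory GRing.Theory Num.Theory numFieldNormedType.Exports.
Local Open Scope classical_set_scope.
Local Open Scope ring_scope.
Set Implicit Arguments. Unset Strict Implicit. Unset Printing Implicit Defensive.

(** * Relative computability *)

Section PairCodes.
Local Open Scope nat_scope.

(** Real data are known only through approximations, so optimality cannot be recognised by comparing
    exact values; integer bounds are compared instead. An accepted lasso is a certificate that is
    valid whatever its precision, and convergence serves only to show that some certificate exists.
    Both ends of each enclosure are carried because negation exchanges them.

    Cutting a path at an arbitrary repeated type could leave an undiscounted until whose value is
    promised forever and never attained. The loop is therefore a tour through all types that recur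
    along the path, so that whatever happens infinitely often on the path also does on the lasso.
    Until is evaluated in two ways, as a supremum over all positions for arbitrary paths and as a
    finite maximum for lassos; the program runs only the second, and the two agree on lassos. *)

Definition unpair : nat -> nat * nat := Cantor.of_nat.

Lemma unpairK n : pair_code (unpair n).1 (unpair n).2 = n.
Proof. by rewrite /pair_code -surjective_pairing; exact: Cantor.cancel_to_of. Qed.

Lemma pair_codeK a b : unpair (pair_code a b) = (a, b).
Proof. exact: Cantor.cancel_of_to. Qed.

Lemma leq_pair_code a b : a + b <= pair_code a b.
Proof. by apply/ssrnat.leP; rewrite addnC; exact: Cantor.to_nat_non_decreasing. Qed.

Lemma pair_code_mono a b a' b' :
  a <= a' -> b <= b' -> pair_code a b <= pair_code a' b'.
Proof.
move=> ha hb; rewrite -(leq_pmul2r (isT : 0 < 2)).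
have E x y : pair_code x y * 2 = y * 2 + (y + x) * (y + x).+1.
  exact: Cantor.to_nat_spec.
by rewrite !E leq_add ?leq_mul ?ltnS ?leq_add.
Qed.

(** The code of a tail is not a structural subterm of [n], hence the fuel. It is strictly smaller
    than [n], so [n] itself is enough fuel. *)
Fixpoint unseq_fuel (k n : nat) : seq nat :=
  if k is k'.+1 then
    if n is n'.+1 then (unpair n').1 :: unseq_fuel k' (unpair n').2 else [::]
  else [::].

Definition unseq (n : nat) : seq nat := unseq_fuel n n.

Lemma unseqK n : seq_code (unseq n) = n.
Proof.
rewrite /unseq; have : n <= n by [].
move: {2 3}n => k; elim: k n => [|k IH] [|n] //= hn.
rewrite IH ?unpairK //; rewrite ltnS in hn; apply: leq_trans hn.
apply: (@leq_trans (pair_code (unpair n).1 (unpair n).2)); last by rewrite unpairK.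
by apply: leq_trans (leq_pair_code _ _); exact: leq_addl.
Qed.

Lemma seq_codeK s : unseq (seq_code s) = s.
Proof.
have inj : injective seq_code.
  elim=> [|a s1 IH] [|b s2] //= [] /pair_code_inj[-> /IH ->] //.
by apply: inj; rewrite unseqK.
Qed.

Lemma mem_seq_code_lt x s : x \in s -> x < seq_code s.
Proof.
elim: s => //= a s IH; rewrite inE ltnS => /orP[/eqP->|/IH h];
  apply: leq_trans (leq_pair_code _ _); first exact: leq_addr.
by apply: leq_trans (ltnW h) _; exact: leq_addl.
Qed.

Lemma size_seq_code s : size s <= seq_code s.
Proof.
elim: s => //= a s IH; rewrite ltnS; apply: leq_trans (leq_pair_code _ _).
by apply: leq_trans IH _; exact: leq_addl.
Qed.

End PairCodes.

Section Computable.
Local Open Scope nat_scope.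

Class encoding (T : Type) := encode : T -> nat.
#[global] Instance encoding_nat : encoding nat := id.
#[global] Instance encoding_bool : encoding bool := nat_of_bool.
#[global] Instance encoding_prod A B {eA : encoding A} {eB : encoding B} :
  encoding (A * B) := fun p => pair_code (encode p.1) (encode p.2).
#[global] Instance encoding_seq A {eA : encoding A} : encoding (seq A) :=
  fun s => seq_code (map encode s).

(** One program serves all oracles, since the final program is chosen before the oracle. Only total
    functions are treated: the unbounded search [PMu] is applied once, at the very end. *)
Definition computable {X T} {eX : encoding X} {eT : encoding T}
    (f : (nat -> nat) -> X -> T) : Prop :=
  exists p, forall O x, run O p (encode x) (encode (f O x)).

Lemma encode_seq_nat (s : seq nat) : encode s = seq_code s.
Proof. by congr seq_code; exact: map_id. Qed.

Definition pid := PPair PFst PSnd.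

Lemma run_id O x : run O pid x x.
Proof.
rewrite -{2}(unpairK x); apply: run_pair; rewrite -{1}(unpairK x).
  exact: run_fst.
exact: run_snd.
Qed.

Lemma computable_id X (eX : encoding X) : computable (fun O (x : X) => x).
Proof. by exists pid => O x; exact: run_id. Qed.

Section Closure.
Variables (X : Type) (eX : encoding X).

Lemma computable_zero : computable (fun O (x : X) => 0).
Proof. by exists PZero => O x; exact: run_zero. Qed.

Lemma computable_succ f :
  computable f -> computable (fun O (x : X) => (f O x).+1).
Proof.
by case=> p hp; exists (PComp PSucc p) => O x; apply: run_comp (hp _ _) (run_succ _ _).
Qed.

Lemma computable_const (n : nat) : computable (fun O (x : X) => n).
Proof.
by elim: n => [|n IH]; [exact: computable_zero | exact: (computable_succ IH)].
Qed.

Lemma computable_oracle f :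
  computable f -> computable (fun O (x : X) => O (f O x)).
Proof.
by case=> p hp; exists (PComp POracle p) => O x; apply: run_comp (hp _ _) (run_oracle _ _).
Qed.

Lemma computable_pair A B (eA : encoding A) (eB : encoding B)
    (f : (nat -> nat) -> X -> A) (g : (nat -> nat) -> X -> B) :
  computable f -> computable g -> computable (fun O x => (f O x, g O x)).
Proof.
by case=> p hp [q hq]; exists (PPair p q) => O x; exact: run_pair.
Qed.

Lemma computable_fst A B (eA : encoding A) (eB : encoding B)
    (f : (nat -> nat) -> X -> A * B) :
  computable f -> computable (fun O x => (f O x).1).
Proof.
by case=> p hp; exists (PComp PFst p) => O x; apply: run_comp (hp _ _) (run_fst _ _ _).
Qed.

Lemma computable_snd A B (eA : encoding A) (eB : encoding B)
    (f : (nat -> nat) -> X -> A * B) :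
  computable f -> computable (fun O x => (f O x).2).
Proof.
by case=> p hp; exists (PComp PSnd p) => O x; apply: run_comp (hp _ _) (run_snd _ _ _).
Qed.

Lemma computable_comp A B (eA : encoding A) (eB : encoding B)
    (g : (nat -> nat) -> A -> B) (f : (nat -> nat) -> X -> A) :
  computable g -> computable f -> computable (fun O x => g O (f O x)).
Proof.
by case=> q hq [p hp]; exists (PComp q p) => O x; apply: run_comp (hp _ _) (hq _ _).
Qed.

Lemma computable_pair_code f g :
  computable f -> computable g ->
  computable (fun O (x : X) => pair_code (f O x) (g O x)).
Proof.
by case=> p hp [q hq]; exists (PPair p q) => O x; exact: run_pair.
Qed.

(** Lists and pairs of numbers are encoded by [seq_code] and [pair_code], so this conversion,
    [unpair] and [unseq] are the identity on codes and the program of [f] serves unchanged. *)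
Lemma computable_seq_code (f : (nat -> nat) -> X -> seq nat) :
  computable f -> computable (fun O x => seq_code (f O x)).
Proof.
by case=> p hp; exists p => O x; move: (hp O x); rewrite encode_seq_nat.
Qed.

Lemma computable_unpair f :
  computable f -> computable (fun O (x : X) => unpair (f O x)).
Proof.
case=> p hp; exists p => O x; have -> : encode (unpair (f O x)) = encode (f O x) by exact: unpairK.
exact: hp.
Qed.

Lemma computable_unseq f :
  computable f -> computable (fun O (x : X) => unseq (f O x)).
Proof.
case=> p hp; exists p => O x; move: (hp O x).
by rewrite encode_seq_nat unseqK.
Qed.

(** The encoding of [X * (nat * T)] has exactly the layout [pair_code a (pair_code n y)] that
    [run_recS] hands to its step program, so nothing has to be repacked. *)
Lemma computable_nat_rect T (eT : encoding T) (f : (nat -> nat) -> X -> T)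
    (g : (nat -> nat) -> X -> nat -> T -> T) (h : (nat -> nat) -> X -> nat) :
  computable f ->
  computable (fun O (z : X * (nat * T)) => g O z.1 z.2.1 z.2.2) ->
  computable h ->
  computable (fun O x => nat_rect (fun _ => T) (f O x) (g O x) (h O x)).
Proof.
case=> p hp [q hq] [r hr]; exists (PComp (PRec p q) (PPair pid r)) => O x.
apply: run_comp (run_pair (run_id _ _) (hr O x)) _.
rewrite /encode /encoding_nat; elim: (h O x) => [|n IH] /=.
  exact: run_rec0.
by apply: run_recS IH _; exact: (hq O (x, (n, _))).
Qed.

End Closure.

Lemma computable_pred X (eX : encoding X) f :
  computable f -> computable (fun O (x : X) => (f O x).-1).
Proof.
move=> hf; have : computable (fun O (x : X) =>
    nat_rect (fun _ => nat) 0 (fun n _ => n) (f O x)).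
  apply: (@computable_nat_rect _ _ _ _ _ (fun O (x : X) n _ => n)) => //.
    exact: computable_zero.
  exact/computable_fst/computable_snd/computable_id.
by case=> p hp; exists p => O x; move: (hp O x); case: (f O x).
Qed.

(* Primitive recursion is the only conditional: the branch [g] is only run when
   the recursion counter is 1, hence only on codes of nonempty lists. *)
Lemma computable_seq_case X A T (eX : encoding X) (eA : encoding A)
    (eT : encoding T) (l : (nat -> nat) -> X -> seq A)
    (f : (nat -> nat) -> X -> T) (g : (nat -> nat) -> X -> A -> seq A -> T) :
  computable l -> computable f ->
  computable (fun O (z : X * (A * seq A)) => g O z.1 z.2.1 z.2.2) ->
  computable (fun O x => if l O x is a :: s then g O x a s else f O x).
Proof.
case=> pl hl [p hp] [q hq].
have [pp hpp] := @computable_pred _ encoding_nat _ (computable_id encoding_nat).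
have [ps hps] : computable (fun O (x : nat) => nat_rect (fun _ => nat) 0 (fun _ _ => 1) x).
  apply: (@computable_nat_rect _ _ _ _ _ (fun O x _ _ => 1)); first exact: computable_zero.
    exact: computable_const.
  exact: computable_id.
pose base := PComp p PFst.
(* The code of [a :: s] is the successor of a pair of codes, so its predecessor is already the
   argument that [q] expects. *)
pose step := PComp q (PPair (PComp PFst PFst) (PComp pp (PComp PSnd PFst))).
exists (PComp (PRec base step) (PPair (PPair pid pl) (PComp ps pl))) => O x.
apply: (run_comp (y := pair_code (pair_code (encode x) (encode (l O x)))
   (if l O x is [::] then 0 else 1))).
  apply: run_pair; first exact: run_pair (run_id _ _) (hl O x).
  apply: run_comp (hl O x) _.
  have hs := hps O (encoding_seq (l O x)).
  by case: (l O x) hs => [|a s]; apply.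
case E: (l O x) => [|a s].
  apply: run_rec0; apply: run_comp (run_fst _ _ _) (hp _ _).
apply: (run_recS (y := encode (f O x))).
  by apply: run_rec0; apply: run_comp (run_fst _ _ _) (hp _ _).
apply: run_comp (hq O (x, (a, s))).
apply: run_pair; first exact: run_comp (run_fst _ _ _) (run_fst _ _ _).
apply: run_comp; first exact: run_comp (run_fst _ _ _) (run_snd _ _ _).
exact: (hpp O (encode (a :: s))).
Qed.

Lemma computable_if X T (eX : encoding X) (eT : encoding T)
    (b : (nat -> nat) -> X -> bool) (f g : (nat -> nat) -> X -> T) :
  computable b -> computable f -> computable g ->
  computable (fun O x => if b O x then f O x else g O x).
Proof.
move=> hb hf hg; have hb' : computable (fun O x => nat_of_bool (b O x)) by [].
have : computable (fun O (x : X) =>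
    nat_rect (fun _ => T) (g O x) (fun _ _ => f O x) (b O x)).
  apply: (@computable_nat_rect _ _ _ _ _ (fun O (x : X) _ _ => f O x)) => //.
  exact/computable_comp/computable_fst/computable_id.
by case=> p hp; exists p => O x; move: (hp O x); case: (b O x).
Qed.

Lemma eq_computable X T (eX : encoding X) (eT : encoding T)
    (f g : (nat -> nat) -> X -> T) :
  (forall O x, f O x = g O x) -> computable f -> computable g.
Proof. by move=> fg [p hp]; exists p => O x; rewrite -fg. Qed.

End Computable.

(** * Computable arithmetic and bounded minima and maxima *)

Section ListsAndArithmetic.
Local Open Scope nat_scope.

Section Below.
Implicit Types (n S : nat) (f : nat -> nat).

(** These are written with [nat_rect] so that [computable_nat_rect] applies to them directly. In
    [min_below] the number [S] is the value of the empty minimum, that is, the truth value 1 at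
    scale [S]. *)
Definition max_below n f := nat_rect (fun _ => nat) 0 (fun i m => maxn m (f i)) n.

Definition min_below S n f := nat_rect (fun _ => nat) S (fun i m => minn m (f i)) n.

Definition all_below n (p : nat -> bool) :=
  nat_rect (fun _ => bool) true (fun i b => b && p i) n.

Lemma all_belowP n (p : nat -> bool) : reflect (forall i, i < n -> p i) (all_below n p).
Proof.
elim: n => [|n IH] /=; first exact: ReflectT.
apply: (iffP andP) => [[/IH h pn] i|h].
  by rewrite ltnS leq_eqVlt => /predU1P[->//|]; exact: h.
by split; [apply/IH => i hi; apply/h/ltnW | exact: h].
Qed.

Lemma leq_max_below n f i : i < n -> f i <= max_below n f.
Proof.
elim: n => //= n IH; rewrite ltnS leq_eqVlt leq_max => /predU1P[->|/IH->//].
by rewrite leqnn orbT.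
Qed.

Lemma max_below_leq n f m : (forall i, i < n -> f i <= m) -> max_below n f <= m.
Proof.
elim: n => //= n IH h; rewrite geq_max h // andbT.
by apply: IH => i hi; apply/h/ltnW.
Qed.

Lemma leq_min_below S n f m :
  (m <= min_below S n f) <-> (m <= S /\ forall i, i < n -> m <= f i).
Proof.
elim: n => [|n IH] /=; first by split=> [|[]].
rewrite leq_min; split=> [/andP[/IH[h1 h2] h3]|[h1 h2]].
  by split=> // i; rewrite ltnS leq_eqVlt => /predU1P[->//|]; exact: h2.
by rewrite h2 // andbT; apply/IH; split=> // i hi; apply/h2/ltnW.
Qed.

Lemma eq_max_below n f g :
  (forall i, i < n -> f i = g i) -> max_below n f = max_below n g.
Proof.
by elim: n => //= n IH h; rewrite h // IH // => i hi; apply/h/ltnW.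
Qed.

Lemma eq_min_below S n f g :
  (forall i, i < n -> f i = g i) -> min_below S n f = min_below S n g.
Proof.
by elim: n => //= n IH h; rewrite h // IH // => i hi; apply/h/ltnW.
Qed.

End Below.

Section Closure.
Variables (X : Type) (eX : encoding X).
Implicit Types (f g : (nat -> nat) -> X -> nat).

Lemma computable_addn f g :
  computable f -> computable g -> computable (fun O (x : X) => f O x + g O x).
Proof.
move=> hf hg; apply: (@eq_computable _ _ _ _ (fun O x =>
    nat_rect (fun _ => nat) (g O x) (fun _ y => y.+1) (f O x))).
  by move=> O x; elim: (f O x) => //= n ->.
apply: (@computable_nat_rect _ _ _ _ _ (fun O x _ y => y.+1)) => //.
exact/computable_succ/computable_snd/computable_snd/computable_id.
Qed.

Lemma computable_subn f g :
  computable f -> computable g -> computable (fun O (x : X) => f O x - g O x).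
Proof.
move=> hf hg; apply: (@eq_computable _ _ _ _ (fun O x =>
    nat_rect (fun _ => nat) (f O x) (fun _ y => y.-1) (g O x))).
  by move=> O x; elim: (g O x) => [|n /= ->]; rewrite ?subn0 ?subnS.
apply: (@computable_nat_rect _ _ _ _ _ (fun O x _ y => y.-1)) => //.
exact/computable_pred/computable_snd/computable_snd/computable_id.
Qed.

End Closure.

Lemma computable_muln X (eX : encoding X) f g :
  computable f -> computable g -> computable (fun O (x : X) => f O x * g O x).
Proof.
move=> hf hg; apply: (@eq_computable _ _ _ _ (fun O x =>
    nat_rect (fun _ => nat) 0 (fun _ y => g O x + y) (f O x))).
  by move=> O x; elim: (f O x) => //= n ->; rewrite mulSn.
apply: (@computable_nat_rect _ _ _ _ _ (fun O x _ y => g O x + y)) => //.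
  exact: computable_zero.
apply: computable_addn; first exact/computable_comp/computable_fst/computable_id.
exact/computable_snd/computable_snd/computable_id.
Qed.

Lemma computable_expn X (eX : encoding X) f g :
  computable f -> computable g -> computable (fun O (x : X) => f O x ^ g O x).
Proof.
move=> hf hg; apply: (@eq_computable _ _ _ _ (fun O x =>
    nat_rect (fun _ => nat) 1 (fun _ y => f O x * y) (g O x))).
  by move=> O x; elim: (g O x) => //= n ->; rewrite expnS.
apply: (@computable_nat_rect _ _ _ _ _ (fun O x _ y => f O x * y)) => //.
  exact: computable_const.
apply: computable_muln; first exact/computable_comp/computable_fst/computable_id.
exact/computable_snd/computable_snd/computable_id.
Qed.

Section Closure.
Variables (X : Type) (eX : encoding X).
Implicit Types (f g : (nat -> nat) -> X -> nat) (b c : (nat -> nat) -> X -> bool).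

Lemma computable_true : computable (fun O (x : X) => true).
Proof. exact: (computable_const eX 1). Qed.

Lemma computable_false : computable (fun O (x : X) => false).
Proof. exact: (computable_const eX 0). Qed.

Lemma computable_andb b c :
  computable b -> computable c -> computable (fun O (x : X) => b O x && c O x).
Proof. by move=> hb hc; apply: computable_if => //; exact: computable_false. Qed.

Lemma computable_orb b c :
  computable b -> computable c -> computable (fun O (x : X) => b O x || c O x).
Proof. by move=> hb hc; apply: computable_if => //; exact: computable_true. Qed.

Lemma computable_implb b c :
  computable b -> computable c -> computable (fun O (x : X) => b O x ==> c O x).
Proof. by move=> hb hc; apply: computable_if => //; exact: computable_true. Qed.

Lemma computable_nat_of_bool b :
  computable b -> computable (fun O (x : X) => b O x : nat).
Proof. by []. Qed.

Lemma computable_leq f g :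
  computable f -> computable g -> computable (fun O (x : X) => f O x <= g O x).
Proof.
move=> hf hg; apply: (@eq_computable _ _ _ _ (fun O x =>
    nat_rect (fun _ => bool) true (fun _ _ => false) (f O x - g O x))).
  by move=> O x; rewrite /leq; case: (f O x - g O x).
apply: (@computable_nat_rect _ _ _ _ _ (fun O (x : X) _ _ => false)).
- exact: computable_true.
- exact: (@computable_const _ _ 0).
- exact: computable_subn.
Qed.

Lemma computable_eqn f g :
  computable f -> computable g -> computable (fun O (x : X) => f O x == g O x).
Proof.
move=> hf hg; apply: (@eq_computable _ _ _ _ (fun O x =>
    (f O x <= g O x) && (g O x <= f O x))).
  by move=> O x; rewrite eqn_leq.
by apply: computable_andb; exact: computable_leq.
Qed.

Lemma computable_minn f g :
  computable f -> computable g -> computable (fun O (x : X) => minn (f O x) (g O x)).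
Proof.
by move=> hf hg; apply: computable_if => //; apply/computable_leq => //; exact: computable_succ.
Qed.

Lemma computable_maxn f g :
  computable f -> computable g -> computable (fun O (x : X) => maxn (f O x) (g O x)).
Proof.
by move=> hf hg; apply: computable_if => //; apply/computable_leq => //; exact: computable_succ.
Qed.

End Closure.

Section Composition.
Variables (Y X A B T : Type).
Variables (eY : encoding Y) (eX : encoding X) (eA : encoding A) (eB : encoding B).
Variables (eT : encoding T).
Variables (f : (nat -> nat) -> Y -> X) (a : (nat -> nat) -> Y -> A).
Variables (b : (nat -> nat) -> Y -> B).

Lemma computable_comp2 (h : (nat -> nat) -> X -> A -> T) :
  computable (fun O (z : X * A) => h O z.1 z.2) ->
  computable f -> computable a -> computable (fun O y => h O (f O y) (a O y)).
Proof.
by move=> hh hf ha; exact: (computable_comp hh (computable_pair hf ha)).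
Qed.

Lemma computable_comp3 (h : (nat -> nat) -> X -> A -> B -> T) :
  computable (fun O (z : X * (A * B)) => h O z.1 z.2.1 z.2.2) ->
  computable f -> computable a -> computable b ->
  computable (fun O y => h O (f O y) (a O y) (b O y)).
Proof.
move=> hh hf ha hb.
exact: (computable_comp hh (computable_pair hf (computable_pair ha hb))).
Qed.

End Composition.

End ListsAndArithmetic.

Ltac computable_step :=
  lazymatch goal with
  | |- computable (fun O x => x) => apply computable_id
  | |- computable (fun O x => fst _) => eapply computable_fst
  | |- computable (fun O x => snd _) => eapply computable_snd
  | |- computable (fun O x => pair _ _) => apply computable_pair
  | |- computable (fun O x => true) => apply computable_true
  | |- computable (fun O x => false) => apply computable_false
  | |- computable (fun O x => if _ then _ else _) => apply computable_if
  | |- computable (fun O x => andb _ _) => apply computable_andb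
  | |- computable (fun O x => implb _ _) => apply computable_implb
  | |- computable (fun O x => addn _ _) => apply computable_addn
  | |- computable (fun O x => subn _ _) => apply computable_subn
  | |- computable (fun O x => muln _ _) => apply computable_muln
  | |- computable (fun O x => expn _ _) => apply computable_expn
  | |- computable (fun O x => leq _ _) => apply computable_leq
  | |- computable (fun O x => minn _ _) => apply computable_minn
  | |- computable (fun O x => maxn _ _) => apply computable_maxn
  | |- computable (fun O x => eq_op _ _) => apply computable_eqn
  | |- computable (fun O x => S _) => apply computable_succ
  | |- computable (fun O x => predn _) => apply computable_pred
  | |- computable (fun O x => pair_code _ _) => apply computable_pair_code
  | |- computable (fun O x => seq_code _) => apply computable_seq_code
  | |- computable (fun O x => unpair _) => apply computable_unpair
  | |- computable (fun O x => unseq _) => apply computable_unseq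
  | |- computable (fun O x => nat_rect _ _ _ _) => apply computable_nat_rect
  | |- computable (fun O x => nat_of_bool _) => apply computable_nat_of_bool
  | |- computable (fun O x => O _) => apply computable_oracle
  | |- computable (fun O x => ?n) => apply computable_const
  end.

(** A hook for [computability], redefined once bounded operations and lists are known to be
    computable. *)
Ltac computable_extra := fail.

Ltac computability :=
  lazy beta;
  first [ assumption
        | match goal with
          | h : computable ?g |- computable (fun O x => ?g O _) =>
              refine (computable_comp h _)
          | h : computable (fun O z => ?g O z.1 z.2)
              |- computable (fun O x => ?g O _ _) => refine (computable_comp2 h _ _)
          | h : computable (fun O z => ?g O z.1 z.2.1 z.2.2)
              |- computable (fun O x => ?g O _ _ _) => refine (computable_comp3 h _ _ _)
          end; computability
        | progress computable_extra; computability
        | computable_step; computability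
        | idtac ].

Section LocalFunctions.
Local Open Scope nat_scope.
Variables (X : Type) (eX : encoding X).

Lemma computable_max_below f (h : (nat -> nat) -> X -> nat -> nat) :
  computable f -> computable (fun O (z : X * nat) => h O z.1 z.2) ->
  computable (fun O (x : X) => max_below (f O x) (h O x)).
Proof.
move=> hf hh; by rewrite /max_below;  computability.
Qed.

Lemma computable_min_below s f (h : (nat -> nat) -> X -> nat -> nat) :
  computable s -> computable f -> computable (fun O (z : X * nat) => h O z.1 z.2) ->
  computable (fun O (x : X) => min_below (s O x) (f O x) (h O x)).
Proof.
move=> hs hf hh; by rewrite /min_below;  computability.
Qed.

Lemma computable_all_below f (h : (nat -> nat) -> X -> nat -> bool) :
  computable f -> computable (fun O (z : X * nat) => h O z.1 z.2) ->
  computable (fun O (x : X) => all_below (f O x) (h O x)).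
Proof.
move=> hf hh; by rewrite /all_below;  computability.
Qed.

(** The quotient counts the positive multiples of the divisor up to the dividend; the guard
    [0 < g O x] makes division by 0 give 0. *)
Lemma computable_divn f g :
  computable f -> computable g -> computable (fun O (x : X) => f O x %/ g O x).
Proof.
move=> hf hg; apply: (@eq_computable _ _ _ _ (fun O x =>
    nat_rect (fun _ => nat) 0 (fun i y => y + ((0 < g O x) && (i.+1 * g O x <= f O x)))
      (f O x))); last first.
  by computability.
move=> O x; case: (posnP (g O x)) => [->|h] /=.
  by rewrite divn0; elim: (f O x) => //= n ->.
have E n : n <= f O x -> nat_rect (fun=> nat) 0
  (fun i y => y + (i.+1 * g O x <= f O x)) n = minn n (f O x %/ g O x).
  elim: n => [|n IH] /= hn; first by rewrite min0n.
  rewrite IH ?(ltnW hn) // -leq_divRL //; lia.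
by rewrite E // (minn_idPr (leq_div _ _)).
Qed.
End LocalFunctions.

(** * Computable list operations and course-of-values recursion *)

Section Lists.
Local Open Scope nat_scope.

Lemma computable_nil X A (eX : encoding X) (eA : encoding A) :
  computable (fun O (x : X) => [::] : seq A).
Proof. by exists PZero => O x; exact: run_zero. Qed.

Lemma computable_cons X A (eX : encoding X) (eA : encoding A)
    (a : (nat -> nat) -> X -> A) (s : (nat -> nat) -> X -> seq A) :
  computable a -> computable s -> computable (fun O x => a O x :: s O x).
Proof.
case=> p hp [q hq]; exists (PComp PSucc (PPair p q)) => O x.
by apply: run_comp (run_succ _ _); exact: run_pair.
Qed.

Section Seq.
Variables (X A T : Type) (eX : encoding X) (eA : encoding A) (eT : encoding T).
Variables (s : (nat -> nat) -> X -> seq A).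
Hypothesis hs : computable s.

Lemma computable_encode : computable (fun O x => encode (s O x)).
Proof. exact: hs. Qed.

Lemma computable_head (d : (nat -> nat) -> X -> A) :
  computable d -> computable (fun O x => head (d O x) (s O x)).
Proof.
move=> hd; apply: (@computable_seq_case _ _ _ _ _ _ s d (fun O x a _ => a)) => //.
by computability.
Qed.

Lemma computable_behead : computable (fun O x => behead (s O x)).
Proof.
apply: (@computable_seq_case _ _ _ _ _ _ s (fun _ _ => [::]) (fun O x _ t => t)) => //.
  exact: computable_nil.
by computability.
Qed.

(** The fold becomes an iteration that consumes one element per round. The code of the list bounds
    its length and is used as the number of rounds; surplus rounds idle on the empty list. *)
Lemma computable_foldl (g : (nat -> nat) -> X -> T -> A -> T)
    (z : (nat -> nat) -> X -> T) :
  computable (fun O (y : X * (T * A)) => g O y.1 y.2.1 y.2.2) -> computable z ->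
  computable (fun O x => foldl (g O x) (z O x) (s O x)).
Proof.
move=> hg hz.
pose step O x (y : seq A * T) := if y.1 is a :: t then (t, g O x y.2 a) else y.
apply: (@eq_computable _ _ _ _ (fun O x => (nat_rect (fun _ => (seq A * T)%type)
    (s O x, z O x) (fun _ => step O x) (encode (s O x))).2)).
  move=> O x; have : size (s O x) <= encode (s O x).
    by rewrite -(size_map encode); exact: size_seq_code.
  move: (encode _) => n; move: (s O x) (z O x) => t y hn.
  have E m r : nat_rect (fun _ => (seq A * T)%type) r (fun _ => step O x) m =
      iter m (step O x) r by elim: m => //= m ->.
  have Enil m r : iter m (step O x) ([::], r) = ([::], r) by elim: m => //= m ->.
  rewrite E; elim: n t y hn => [|n IH] [|a t] y // hn; first by rewrite Enil.
  by rewrite iterSr; exact: IH.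
apply: computable_snd; apply: computable_nat_rect; last exact: computable_encode.
  exact: computable_pair.
by rewrite /step; apply: computable_seq_case; computability.
Qed.

End Seq.

Section Seq.
Variables (X A T : Type) (eX : encoding X) (eA : encoding A) (eT : encoding T).
Variables (s : (nat -> nat) -> X -> seq A).
Hypothesis hs : computable s.

Lemma computable_rev : computable (fun O x => rev (s O x)).
Proof.
apply: (@eq_computable _ _ _ _ (fun O x => foldl (fun t a => a :: t) [::] (s O x))).
  by move=> O x; rewrite /rev; move: [::]; elim: (s O x) => //= a t IH r; rewrite IH.
apply: computable_foldl => //; last exact: computable_nil.
by apply: computable_cons; computability.
Qed.

Lemma computable_size : computable (fun O x => size (s O x)).
Proof.
apply: (@eq_computable _ _ _ _ (fun O x => foldl (fun t _ => t.+1) 0 (s O x))).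
  move=> O x; rewrite -[RHS]addn0; move: 0; elim: (s O x) => //= a t IH n.
  by rewrite IH addSnnS.
by apply: computable_foldl => //; computability.
Qed.

Lemma computable_drop n :
  computable n -> computable (fun O x => drop (n O x) (s O x)).
Proof.
move=> hn; apply: (@eq_computable _ _ _ _ (fun O x =>
    nat_rect (fun _ => seq A) (s O x) (fun _ => behead) (n O x))).
  move=> O x; elim: (n O x) => [|m /= ->]; first by rewrite drop0.
  by rewrite -drop1 drop_drop add1n.
apply: computable_nat_rect => //.
by apply: computable_behead; computability.
Qed.

End Seq.

Section Seq.
Variables (X A T : Type) (eX : encoding X) (eA : encoding A) (eT : encoding T).
Variables (s : (nat -> nat) -> X -> seq A).
Hypothesis hs : computable s.

Lemma computable_nth d n :
  computable d -> computable n -> computable (fun O x => nth (d O x) (s O x) (n O x)).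
Proof.
move=> hd hn; apply: (@eq_computable _ _ _ _ (fun O x =>
   head (d O x) (drop (n O x) (s O x)))).
  by move=> O x; rewrite -nth0 nth_drop addn0.
by apply: computable_head => //; exact: computable_drop.
Qed.

Lemma computable_rcons a :
  computable a -> computable (fun O x => rcons (s O x) (a O x)).
Proof.
move=> ha; apply: (@eq_computable _ _ _ _ (fun O x => rev (a O x :: rev (s O x)))).
  by move=> O x; rewrite rev_cons revK.
by apply: computable_rev; apply: computable_cons => //; exact: computable_rev.
Qed.

Lemma computable_cat t :
  computable t -> computable (fun O x => s O x ++ t O x).
Proof.
move=> ht; apply: (@eq_computable _ _ _ _ (fun O x =>
    foldl (fun r a => a :: r) (t O x) (rev (s O x)))).
  by move=> O x; rewrite foldl_rev; elim: (s O x) => //= a r ->.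
apply: computable_foldl => //; first exact: computable_rev.
by apply: computable_cons; computability.
Qed.

End Seq.

Lemma computable_map X A T (eX : encoding X) (eA : encoding A) (eT : encoding T)
    (f : (nat -> nat) -> X -> A -> T) (s : (nat -> nat) -> X -> seq A) :
  computable (fun O (z : X * A) => f O z.1 z.2) -> computable s ->
  computable (fun O x => map (f O x) (s O x)).
Proof.
move=> hf hs; apply: (@eq_computable _ _ _ _ (fun O x =>
    foldl (fun r a => f O x a :: r) [::] (rev (s O x)))).
  by move=> O x; rewrite foldl_rev; elim: (s O x) => //= a r ->.
apply: computable_foldl; first exact: computable_rev.
  apply: computable_cons; last by computability.
  by apply: (computable_comp2 hf); computability.
exact: computable_nil.
Qed.

Lemma computable_mem X (eX : encoding X) (a : (nat -> nat) -> X -> nat)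
    (s : (nat -> nat) -> X -> seq nat) :
  computable a -> computable s -> computable (fun O x => a O x \in s O x).
Proof.
move=> ha hs; apply: (@eq_computable _ _ _ _ (fun O x =>
    foldl (fun (b : bool) y => b || (a O x == y)) false (s O x))).
  move=> O x; rewrite -[RHS]orFb; move: false; elim: (s O x) => [|y t IH] b /=.
    by rewrite orbF.
  by rewrite IH inE orbA.
apply: computable_foldl => //; last by computability.
by apply: computable_orb; computability.
Qed.

Lemma computable_mkseq X T (eX : encoding X) (eT : encoding T)
    (f : (nat -> nat) -> X -> nat -> T) n :
  computable (fun O (z : X * nat) => f O z.1 z.2) -> computable n ->
  computable (fun O x => mkseq (f O x) (n O x)).
Proof.
move=> hf hn; apply: (@eq_computable _ _ _ _ (fun O x =>
    nat_rect (fun _ => seq T) [::] (fun i r => rcons r (f O x i)) (n O x))).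
  by move=> O x; elim: (n O x) => //= m ->; rewrite mkseqS.
apply: computable_nat_rect => //; first exact: computable_nil.
apply: computable_rcons; first by computability.
by apply: (computable_comp2 hf); computability.
Qed.

Section CourseOfValues.
Variables (T : Type) (d : T).
Implicit Types (G : nat -> (nat -> T) -> T).

(** The newest entry comes first, so the value at [k < n] has index [size t - k.+1]. For [k >= n]
    the subtraction truncates to 0 and an unrelated entry is read, which is why [cov_recE] asks that
    [G n] depend only on values below [n]. *)
Definition cov_table G n : seq T :=
  nat_rect (fun _ => seq T) [::]
    (fun n t => G n (fun k => nth d t (size t - k.+1)) :: t) n.

Definition cov_rec G n := head d (cov_table G n.+1).

Lemma size_cov_table G n : size (cov_table G n) = n.
Proof. by elim: n => //= n ->. Qed.

Lemma nth_cov_table G n k : k < n -> nth d (cov_table G n) (n - k.+1) = cov_rec G k.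
Proof.
elim: n => // n IH; rewrite ltnS leq_eqVlt => /predU1P[->|kn].
  by rewrite subnn.
by rewrite subSS -IH // -(subnSK kn).
Qed.

Lemma cov_recE G n :
  (forall w w', (forall k, k < n -> w k = w' k) -> G n w = G n w') ->
  cov_rec G n = G n (cov_rec G).
Proof.
move=> hG; apply: hG => k kn.
by rewrite size_cov_table nth_cov_table.
Qed.

End CourseOfValues.

Lemma computable_cov_rec X T (eX : encoding X) (eT : encoding T)
    (d : (nat -> nat) -> X -> T) (G : (nat -> nat) -> X -> nat -> (nat -> T) -> T) n :
  computable d ->
  computable (fun O (z : X * (nat * seq T)) =>
    G O z.1 z.2.1 (fun k => nth (d O z.1) z.2.2 (size z.2.2 - k.+1))) ->
  computable n ->
  computable (fun O x => cov_rec (d O x) (G O x) (n O x)).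
Proof.
move=> hd hG hn; rewrite /cov_rec /cov_table; apply: computable_head => //.
apply: computable_nat_rect; [exact: computable_nil| |exact: computable_succ].
by apply: computable_cons; [exact: hG|computability].
Qed.

End Lists.

Ltac computable_extra ::=
  lazymatch goal with
  | |- computable (fun O x => max_below _ _) => apply computable_max_below
  | |- computable (fun O x => min_below _ _ _) => apply computable_min_below
  | |- computable (fun O x => all_below _ _) => apply computable_all_below
  | |- computable (fun O x => divn _ _) => apply computable_divn
  | |- computable (fun O x => nil) => apply computable_nil
  | |- computable (fun O x => cons _ _) => apply computable_cons
  | |- computable (fun O x => nth _ _ _) => eapply computable_nth
  | |- computable (fun O x => size _) => eapply computable_size
  | |- computable (fun O x => drop _ _) => apply computable_drop
  | |- computable (fun O x => cat _ _) => apply computable_cat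
  | |- computable (fun O x => map _ _) => eapply computable_map
  | |- computable (fun O x => mkseq _ _) => apply computable_mkseq
  | |- computable (fun O x => in_mem _ (mem _)) => apply computable_mem
  end.

(** * Quantised semantics and the search *)

Section QuantisedSemantics.
Local Open Scope nat_scope.

Definition until_term S (f g : nat -> nat) i k :=
  minn (g (i + k)) (min_below S k (fun j => f (i + j))).

(** Here [e k] is meant to be within 1 of [S] times the k-th discount, so [(e k).-1] and [(e k).+1]
    enclose it. Omitting the terms from the horizon on is harmless for a lower bound of a
    supremum. *)
Definition discounted_low S h (e f g : nat -> nat) i :=
  max_below h (fun k => minn ((e k).-1 * g (i + k) %/ S)
    (min_below S k (fun j => (e j).-1 * f (i + j) %/ S))).

(* Only the terms before the horizon [h] are evaluated; each later one is at
   most eta h, which [(e h).+1] bounds. *)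
Definition discounted_up S h (e f g : nat -> nat) i :=
  maxn (e h).+1 (max_below h (fun k => minn ((e k).+1 * g (i + k) %/ S).+1
    (min_below S k (fun j => ((e j).+1 * f (i + j) %/ S).+1)))).

Definition arg c k := nth 0 (unseq c) k.

(* One step of the evaluation of the formula with code [c] at scale [2 ^ n]:
   [w a i] is a pair (lower bound, upper bound) for the immediate subformula
   with code [a] at position [i], and [U] evaluates undiscounted until. *)
Definition eval_step (O : nat -> nat) n
    (U : (nat -> nat) -> (nat -> nat) -> nat -> nat) (lab : nat -> seq nat)
    c (w : nat -> nat -> nat * nat) i : nat * nat :=
  let S := 2 ^ n in
  let low k j := (w (arg c k) j).1 in
  let up k j := (w (arg c k) j).2 in
  let e k := O (pair_code (arg c 1) (pair_code k n)) in
  let q s := O (pair_code (arg c 1) (pair_code (pair_code n (seq_code s)) n)) in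
  let r :=
    if arg c 0 == 0 then (S, S)
    else if arg c 0 == 1 then (if arg c 1 \in lab i then (S, S) else (0, 0))
    else if arg c 0 == 2 then (S - up 1 i, S - low 1 i)
    else if arg c 0 == 3 then (minn (low 1 i) (low 2 i), minn (up 1 i) (up 2 i))
    else if arg c 0 == 4 then w (arg c 1) i.+1
    else if arg c 0 == 5 then (U (low 1) (low 2) i, U (up 1) (up 2) i)
    else if arg c 0 == 6 then
      (discounted_low S n e (low 2) (low 3) i, discounted_up S n e (up 2) (up 3) i)
    else ((q (map (fun a => (w a i).1) (drop 2 (unseq c)))).-1,
          (q (map (fun a => (w a i).2) (drop 2 (unseq c)))).+1)
  (* Clipping leaves finitely many values, even at numbers that code no formula, and makes every
     value an admissible coordinate for a later operator query. *)
  in (minn S r.1, minn S r.2).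

Lemma computable_modn X (eX : encoding X) (f g : (nat -> nat) -> X -> nat) :
  computable f -> computable g -> computable (fun O x => f O x %% g O x).
Proof.
move=> hf hg; apply: (@eq_computable _ _ _ _ (fun O x =>
    f O x - f O x %/ g O x * g O x)); last by computability.
by move=> O x; rewrite {1}(divn_eq (f O x) (g O x)) addKn.
Qed.

Definition lasso_position b p i := if i < b then i else b + (i - b) %% p.

Definition lasso_state u v i : nat :=
  nth 0 (u ++ v) (lasso_position (size u) (size v) i).

Definition lasso_until S m f g i := max_below m (until_term S f g i).

Definition lasso_table O n lab b p : nat -> seq (nat * nat) :=
  cov_rec [::] (fun c w => mkseq (fun i =>
    eval_step O n (lasso_until (2 ^ n) (b + p)) lab c
      (fun a j => nth (0, 0) (w a) (lasso_position b p j)) i) (b + p)).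

Definition kripke_data k : seq (seq nat * seq nat) :=
  map (fun e => (unseq (unpair e).1, unseq (unpair e).2)) (unseq k).

Definition lasso_value O n (kd : seq (seq nat * seq nat)) u v c : nat * nat :=
  nth (0, 0)
    (lasso_table O n (fun i => (nth ([::], [::]) kd (lasso_state u v i)).2)
      (size u) (size v) c) 0.

Definition lasso_valid (kd : seq (seq nat * seq nat)) u v :=
  (0 < size v) && all_below (size u + size v) (fun i =>
    lasso_state u v i.+1 \in (nth ([::], [::]) kd (lasso_state u v i)).1).

(* Number of pairs (state, window) where a window holds, for each code up to [c]
   and each of [n.+2] consecutive positions, a lower and an upper bound. *)
Definition type_bound N n c :=
  N * ((2 ^ n).+1 * (2 ^ n).+1) ^ (c.+1 * n.+2).

(** This is the code of the list of [m] copies of [N]; since pairing is monotone, it bounds the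
    codes of shorter lists with smaller entries. *)
Definition code_bound N m : nat := nat_rect _ 0 (fun _ y => (pair_code N y).+1) m.

(* Bounds the codes of lists of at most [(q + 2) ^ 2] numbers up to [N], where q
   is [type_bound N n c]. *)
Definition lasso_bound N n c :=
  code_bound N ((type_bound N n c).+2 * (type_bound N n c).+2).

(** The number [m] packs a precision with the two halves of a lasso, so one unbounded search ranges
    over both. The inequality is strict because the oracle gives [2 ^ n] times eps only up to an
    error of 1. *)
Definition accepts O (x : seq nat) m : bool :=
  let kd := kripke_data (nth 0 x 0) in
  let c := nth 0 x 1 in
  let n := (unpair m).1 in
  let u := unseq (unpair (unpair m).2).1 in
  let v := unseq (unpair (unpair m).2).2 in
  let C := (lasso_bound (size kd) n c).+1 in
  lasso_valid kd u v && all_below C (fun a => all_below C (fun b =>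
    lasso_valid kd (unseq a) (unseq b) ==>
      ((lasso_value O n kd (unseq a) (unseq b) c).2 <
        (lasso_value O n kd u v c).1 + O (pair_code (nth 0 x 2) n)))).

End QuantisedSemantics.

(** * Computability of the acceptance test *)

Section ComputabilityOfAcceptance.
Local Open Scope nat_scope.

Lemma computable_kripke_data X (eX : encoding X) (k : (nat -> nat) -> X -> nat) :
  computable k -> computable (fun O x => kripke_data (k O x)).
Proof. by move=> hk; rewrite /kripke_data; computability. Qed.

Section Lasso.
Variables (X : Type) (eX : encoding X).
Variables (n c : (nat -> nat) -> X -> nat) (u v : (nat -> nat) -> X -> seq nat).
Variable kd : (nat -> nat) -> X -> seq (seq nat * seq nat).
Hypotheses (hn : computable n) (hc : computable c) (hu : computable u).
Hypotheses (hv : computable v) (hkd : computable kd).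

Lemma computable_lasso_position b p i :
  computable b -> computable p -> computable i ->
  computable (fun O (x : X) => lasso_position (b O x) (p O x) (i O x)).
Proof.
move=> hb hp hi; rewrite /lasso_position; computability.
by apply: computable_modn; computability.
Qed.

Lemma computable_lasso_state i :
  computable i -> computable (fun O (x : X) => lasso_state (u O x) (v O x) (i O x)).
Proof.
move=> hi; rewrite /lasso_state; apply: computable_nth; try by computability.
by apply: computable_lasso_position; computability.
Qed.

Lemma computable_lasso_bound N :
  computable N -> computable (fun O (x : X) => lasso_bound (N O x) (n O x) (c O x)).
Proof. by move=> hN; rewrite /lasso_bound /code_bound /type_bound; computability. Qed.
End Lasso.

Section Lasso.
Variables (X : Type) (eX : encoding X).
Variables (n c : (nat -> nat) -> X -> nat) (u v : (nat -> nat) -> X -> seq nat).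
Variable kd : (nat -> nat) -> X -> seq (seq nat * seq nat).
Hypotheses (hn : computable n) (hc : computable c) (hu : computable u).
Hypotheses (hv : computable v) (hkd : computable kd).

Lemma computable_lasso_valid :
  computable (fun O (x : X) => lasso_valid (kd O x) (u O x) (v O x)).
Proof.
rewrite /lasso_valid; computability.
  by apply: computable_lasso_state; computability.
by apply: computable_lasso_state; computability.
Qed.

Lemma computable_lasso_value :
  computable (fun O (x : X) => lasso_value O (n O x) (kd O x) (u O x) (v O x) (c O x)).
Proof.
rewrite /lasso_value /lasso_table; computability.
apply: computable_cov_rec; try by computability.
rewrite /eval_step /lasso_until /until_term /discounted_low /discounted_up /arg.
computability.
all: first [apply: computable_lasso_state; by computability
  | apply: computable_lasso_position; by computability | idtac].
Qed.

End Lasso.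

Lemma computable_accepts :
  computable (fun O (z : seq nat * nat) => accepts O z.1 z.2).
Proof.
rewrite /accepts; cbv zeta; computability.
all: repeat first [apply: computable_lasso_valid | apply: computable_lasso_value
  | apply: computable_lasso_bound | apply: computable_kripke_data]; computability.
all: by apply: computable_kripke_data; computability.
Qed.

End ComputabilityOfAcceptance.

(** * Quantised values over infinitely many positions and on lassos *)

Section Values.
Local Open Scope nat_scope.

Lemma arg_lt c k : 0 < c -> arg c k < c.
Proof.
move=> c0; rewrite /arg; case: (ltnP k (size (unseq c))) => hk; last by rewrite nth_default.
by rewrite -{2}(unseqK c) mem_seq_code_lt // mem_nth.
Qed.

Lemma arg00 k : arg 0 k = 0.
Proof. by rewrite /arg; case: k. Qed.

Section EqDiscounted.
Variables (S h : nat) (e f f' g g' : nat -> nat) (i i' : nat).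
Hypothesis hf : forall k, k <= h -> f (i + k) = f' (i' + k).
Hypothesis hg : forall k, k <= h -> g (i + k) = g' (i' + k).

Lemma eq_discounted_low : discounted_low S h e f g i = discounted_low S h e f' g' i'.
Proof.
apply: eq_max_below => k hk; rewrite hg; last exact: ltnW.
by congr minn; apply: eq_min_below => j hj; rewrite hf //; lia.
Qed.

Lemma eq_discounted_up : discounted_up S h e f g i = discounted_up S h e f' g' i'.
Proof.
congr maxn; apply: eq_max_below => k hk; rewrite hg; last exact: ltnW.
by congr minn; apply: eq_min_below => j hj; rewrite hf //; lia.
Qed.

End EqDiscounted.

(** Locality of one evaluation step, with until left abstract in [U]. It serves to shift positions,
    to compare the table of a lasso with the semantics, and to transfer values to a pumped path.
    Offsets reach [n.+1] because X needs offset 1 even at precision 0. *)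
Lemma eval_step_congr O n U U' lab lab' c w w' i i' :
  (forall a r, a < c -> r <= n.+1 -> w a (i + r) = w' a (i' + r)) ->
  lab i = lab' i' ->
  (arg c 0 = 5 -> forall sel : nat * nat -> nat, sel = fst \/ sel = snd ->
     U (fun j => sel (w (arg c 1) j)) (fun j => sel (w (arg c 2) j)) i =
     U' (fun j => sel (w' (arg c 1) j)) (fun j => sel (w' (arg c 2) j)) i') ->
  eval_step O n U lab c w i = eval_step O n U' lab' c w' i'.
Proof.
move=> hw hl hU; case: (posnP c) => [->|c0].
  by rewrite /eval_step arg00.
have w0 a : a < c -> w a i = w' a i' by move=> /hw h; have := h 0; rewrite !addn0; apply.
have w1 k : w (arg c k) i = w' (arg c k) i' by rewrite w0 ?arg_lt.
have wr k r : r <= n.+1 -> w (arg c k) (i + r) = w' (arg c k) (i' + r).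
  by move=> h; rewrite hw ?arg_lt.
have ws : w (arg c 1) i.+1 = w' (arg c 1) i'.+1 by rewrite -(addn1 i) -(addn1 i') wr.
have wq : {in drop 2 (unseq c), forall a, w a i = w' a i'}.
  by move=> a /mem_drop /mem_seq_code_lt; rewrite unseqK => /w0.
rewrite /eval_step; move: (2 ^ n) => S; cbv zeta.
case: (arg c 0 == 0) => //.
case: (arg c 0 == 1); first by rewrite hl.
case: (arg c 0 == 2); first by rewrite !w1.
case: (arg c 0 == 3); first by rewrite !w1.
case: (arg c 0 == 4); first by rewrite !ws.
case: eqP => [/hU hU'|_].
  by congr (minn _ _, minn _ _); apply: hU'; [left|right].
case: (arg c 0 == 6).
  congr (minn _ _, minn _ _).
    by apply: eq_discounted_low => // k hk; rewrite wr // ltnW.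
  by apply: eq_discounted_up => // k hk; rewrite wr // ltnW.
have E1 : [seq (w a i).1 | a <- drop 2 (unseq c)] = [seq (w' a i').1 | a <- drop 2 (unseq c)].
  by apply/eq_in_map => a /wq ->.
have E2 : [seq (w a i).2 | a <- drop 2 (unseq c)] = [seq (w' a i').2 | a <- drop 2 (unseq c)].
  by apply/eq_in_map => a /wq ->.
by rewrite E1 E2.
Qed.

(** A supremum of integers bounded by [S], hence attained. The condition is classical, so the
    program does not evaluate it; [lasso_untilE] replaces it by a finite maximum on lassos. *)
Definition sup_below S (h : nat -> nat) : nat :=
  \max_(t < S.+1 | `[< exists k, t <= h k >]) t.

Lemma leq_sup_below S h k : (forall k, h k <= S) -> h k <= sup_below S h.
Proof.
move=> hS; have lt : h k < S.+1 by rewrite ltnS.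
by apply: (@leq_bigmax_cond _ _ (fun t : 'I_S.+1 => t : nat) (Ordinal lt)); apply/asboolP; exists k.
Qed.

Lemma sup_below_leq S h m : (forall k, h k <= m) -> sup_below S h <= m.
Proof.
by move=> hm; apply/bigmax_leqP => t /asboolP[k hk]; apply: leq_trans hk (hm k).
Qed.

Lemma sup_below_attained S h : (forall k, h k <= S) -> exists k, h k = sup_below S h.
Proof.
move=> hS; rewrite /sup_below.
have P0 : `[< exists k, (ord0 : 'I_S.+1) <= h k >] by apply/asboolP; exists 0.
have : 0 < #|[pred t : 'I_S.+1 | `[< exists k, t <= h k >]]|.
  by apply/card_gt0P; exists ord0.
case/(eq_bigmax_cond (fun t : 'I_S.+1 => t : nat)) => t /asboolP[k hk] E; exists k.
by apply/eqP; rewrite eqn_leq leq_sup_below // /sup_below E.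
Qed.

Definition until_sup S f g i := sup_below S (until_term S f g i).

Lemma until_term_leq S f g i k : until_term S f g i k <= S.
Proof.
rewrite /until_term geq_min; apply/orP; right.
by have [] := (leq_min_below S k (fun j => f (i + j)) _).1 (leqnn _).
Qed.

Lemma eq_until_sup S f f' g g' i i' :
  (forall j, f (i + j) = f' (i' + j)) -> (forall j, g (i + j) = g' (i' + j)) ->
  until_sup S f g i = until_sup S f' g' i'.
Proof.
move=> hf hg; congr sup_below; apply: funext => k; rewrite /until_term hg.
by congr minn; apply: eq_min_below => j _.
Qed.

(** The recursion is on formula codes and yields functions of all positions, so it makes sense for
    an arbitrary label sequence. It is the specification against which the program's [lasso_table]
    is checked. *)
Definition values O n lab : nat -> nat -> nat * nat :=
  cov_rec (fun _ => (0, 0)) (fun c w => eval_step O n (until_sup (2 ^ n)) lab c w).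

Lemma valuesE O n lab c i :
  values O n lab c i = eval_step O n (until_sup (2 ^ n)) lab c (values O n lab) i.
Proof.
rewrite /values cov_recE //= => w w' ww'; apply: funext => j.
apply: eval_step_congr => // [a r ac _|a0 sel _]; first by rewrite ww'.
have [c0|c0] := posnP c; first by rewrite c0 arg00 in a0.
by rewrite !ww' ?arg_lt.
Qed.

Lemma values_leq O n lab c i :
  ((values O n lab c i).1 <= 2 ^ n) && ((values O n lab c i).2 <= 2 ^ n).
Proof. by rewrite valuesE /eval_step /= !geq_minl. Qed.

Lemma values_shift O n lab lab' c i i' :
  (forall j, lab (i + j) = lab' (i' + j)) ->
  values O n lab c i = values O n lab' c i'.
Proof.
elim/ltn_ind: c i i' => c IH i i' hl; rewrite !valuesE.
have hw a r : a < c -> values O n lab a (i + r) = values O n lab' a (i' + r).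
  by move=> /IH; apply => j; rewrite -!addnA.
apply: eval_step_congr => [a r ac _||a0 sel _].
- exact: hw.
- by have := hl 0; rewrite !addn0.
have c0 : 0 < c by case: (c) a0 => //; rewrite arg00.
by apply: eq_until_sup => j; rewrite hw ?arg_lt.
Qed.

Lemma values_until O n lab c i (sel : nat * nat -> nat) :
  arg c 0 = 5 -> sel = fst \/ sel = snd ->
  sel (values O n lab c i) = until_sup (2 ^ n)
    (fun j => sel (values O n lab (arg c 1) j))
    (fun j => sel (values O n lab (arg c 2) j)) i.
Proof.
move=> c5 hsel; rewrite valuesE /eval_step c5 /=.
have E f g : minn (2 ^ n) (until_sup (2 ^ n) f g i) = until_sup (2 ^ n) f g i.
  by apply/minn_idPr/sup_below_leq => k; exact: until_term_leq.
by case: hsel => -> /=; rewrite E.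
Qed.

Lemma leq_until_term S f g i k t : (t <= until_term S f g i k) <->
  [/\ t <= S, t <= g (i + k) & forall j, j < k -> t <= f (i + j)].
Proof.
rewrite /until_term leq_min; split=> [/andP[hg /leq_min_below[hS hf]] //|[hS hg hf]].
by rewrite hg /=; apply/leq_min_below.
Qed.

Lemma leq_until_sup S f g i t :
  (t <= until_sup S f g i) <-> exists k, t <= until_term S f g i k.
Proof.
have hS k : until_term S f g i k <= S by exact: until_term_leq.
split=> [ht|[k hk]]; first by have [k hk] := sup_below_attained hS; exists k; rewrite hk.
exact: leq_trans hk (leq_sup_below _ hS).
Qed.

Lemma until_sup_unfold S f g i : (forall j, g j <= S) ->
  until_sup S f g i = maxn (g i) (minn (f i) (until_sup S f g i.+1)).
Proof.
move=> gS; apply/eqP; rewrite eqn_leq; apply/andP; split.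
  apply: sup_below_leq => -[|k]; rewrite leq_max leq_min.
    by rewrite /until_term addn0 geq_minl.
  have /leq_until_term[hS hg hf] := leqnn (until_term S f g i k.+1).
  apply/orP; right; have := hf 0; rewrite addn0 => -> //=.
  apply/leq_until_sup; exists k; apply/leq_until_term; rewrite addSnnS; split=> //.
  by move=> j hj; rewrite addSnnS; apply: hf.
rewrite geq_max; apply/andP; split.
  by apply/leq_until_sup; exists 0; apply/leq_until_term; rewrite addn0.
have [k] := (leq_until_sup S f g i.+1 _).1 (geq_minr (f i) _).
case/leq_until_term => hS hg hf; apply/leq_until_sup; exists k.+1.
apply/leq_until_term; split; rewrite -?addSnnS // => -[|j] hj.
  by rewrite addn0 geq_minl.
by rewrite -addSnnS; apply: hf.
Qed.

(* A solution of the one-step equation of until which never promises the value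
   t forever without fulfilling it is the least one. *)
Lemma until_sup_unique S f g h : (forall k, h k <= S) ->
  (forall k, h k = maxn (g k) (minn (f k) (h k.+1))) ->
  (forall k t, exists2 k', k <= k' & (t <= g k') || (h k' < t)) ->
  forall k, until_sup S f g k = h k.
Proof.
move=> hS hE hful k; apply/eqP; rewrite eqn_leq; apply/andP; split.
  apply: sup_below_leq => i; elim: i k => [|i IH] k; rewrite hE leq_max.
    by rewrite /until_term addn0 geq_minl.
  apply/orP; right; have /leq_until_term[hS' hg hf] := leqnn (until_term S f g k i.+1).
  rewrite leq_min; have := hf 0; rewrite addn0 => -> //=.
  apply: leq_trans (IH _); apply/leq_until_term; rewrite addSnnS; split=> //.
  by move=> j hj; rewrite addSnnS; apply: hf.
(* The number [d] is the distance to a position where the promise of [t] is fulfilled or dropped. By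
   the one-step equation a promise not fulfilled at [m] passes to the next position, and a drop at
   distance 0 contradicts [t <= h m]. *)
have key d : forall m t, t <= h m -> t <= S -> (t <= g (m + d)) || (h (m + d) < t) ->
  t <= until_sup S f g m; last first.
  have [k' kk' hk'] := hful k (h k); apply: (key (k' - k)) => //.
  by rewrite subnKC.
elim: d => [|d IH] m t htk tS hd; apply/leq_until_sup.
  exists 0; apply/leq_until_term; split=> //.
  by case/orP: hd => //; rewrite addn0 ltnNge htk.
move: htk; rewrite hE leq_max leq_min => /orP[hg|/andP[hf htk]].
  by exists 0; apply/leq_until_term; rewrite addn0.
have := IH m.+1 t htk tS; rewrite addSnnS => /(_ hd) /leq_until_sup[i].
case/leq_until_term => _ hg' hf'; exists i.+1; apply/leq_until_term.
split; rewrite -?addSnnS // => -[|j] hj; first by rewrite addn0.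
by rewrite -addSnnS; apply: hf'.
Qed.

Section Lasso.
Variables (b p : nat).
Hypothesis p0 : 0 < p.
Let pos := lasso_position b p.

Lemma lasso_position_lt i : pos i < b + p.
Proof.
rewrite /pos /lasso_position; case: (ltnP i b) => h; first exact: ltn_addr.
by rewrite ltn_add2l ltn_mod.
Qed.

Lemma lasso_position_id i : i < b + p -> pos i = i.
Proof.
rewrite /pos /lasso_position => h; case: (ltnP i b) => // hb.
by rewrite modn_small; lia.
Qed.

Lemma lasso_positionD i j : pos (pos i + j) = pos (i + j).
Proof.
rewrite /pos /lasso_position; case: (ltnP i b) => // hb.
rewrite !ltnNge !(leq_trans _ (leq_addr _ _)) // ?leq_addr //=.
congr (_ + _); rewrite -addnA addKn modnDml.
by congr (_ %% _); lia.
Qed.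

Lemma lasso_positionDp i : b <= i -> pos (i + p) = pos i.
Proof.
rewrite /pos /lasso_position => h; rewrite !ltnNge h (leq_trans h (leq_addr _ _)) /=.
by rewrite -addnBAC // modnDr.
Qed.

(* On a lasso, going once more around the loop only adds terms to the minimum,
   so the supremum is reached before position b + p. *)
Lemma lasso_untilE S f g i :
  (forall j, f (pos j) = f j) -> (forall j, g (pos j) = g j) ->
  lasso_until S (b + p) f g i = until_sup S f g i.
Proof.
move=> hf hg; apply/eqP; rewrite eqn_leq; apply/andP; split.
  apply: max_below_leq => k _; apply: leq_sup_below => ?; exact: until_term_leq.
apply: sup_below_leq; elim/ltn_ind => k IH.
have [hk|hk] := ltnP k (b + p); first exact: leq_max_below.
have lt : k - p < k by lia.
apply: leq_trans (IH _ lt); rewrite /until_term.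
rewrite leq_min geq_min; apply/andP; split.
  apply/orP; left; rewrite -(hg (i + k)) -(hg (i + (k - p))).
  have bi : b <= i + (k - p) by lia.
  by rewrite -(lasso_positionDp bi); apply: eq_leq; congr (g (pos _)); lia.
rewrite geq_min; apply/orP; right.
have [h1 h2] := (leq_min_below S k (fun j => f (i + j)) _).1 (leqnn _).
by apply/leq_min_below; split=> // j hj; apply: h2; lia.
Qed.

(** Values depend only on the labels from a position on, so they are periodic when the labels are.
    Reading the table at wrapped positions therefore gives the values at all positions. *)
Lemma lasso_tableE O n lab c :
  (forall i, lab (pos i) = lab i) ->
  lasso_table O n lab b p c = mkseq (values O n lab c) (b + p).
Proof.
move=> hl.
have perW a i : values O n lab a (pos i) = values O n lab a i.
  by apply: values_shift => j; rewrite -hl lasso_positionD hl.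
elim/ltn_ind: c => c IH; rewrite /lasso_table cov_recE; last first.
  move=> w w' ww'; apply: eq_mkseq => i; apply: eval_step_congr => //.
    by move=> a r ac _; rewrite ww'.
  move=> a0 sel _; have c0 : 0 < c by case: (c) a0 => //; rewrite arg00.
  by rewrite !ww' ?arg_lt.
rewrite -/(lasso_table O n lab b p) -/pos; apply: eq_mkseq => i; rewrite valuesE.
have E a j : a < c -> nth (0, 0) (lasso_table O n lab b p a) (pos j) = values O n lab a j.
  by move=> ac; rewrite IH // nth_mkseq ?lasso_position_lt // perW.
apply: eval_step_congr => // [a r ac _|a0 sel _]; first by rewrite E.
have c0 : 0 < c by case: (c) a0 => //; rewrite arg00.
rewrite -lasso_untilE; last 2 first.
- by move=> j; rewrite perW.
- by move=> j; rewrite perW.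
apply: eq_max_below => k _; rewrite /until_term E ?arg_lt //.
by congr minn; apply: eq_min_below => j _; rewrite E ?arg_lt.
Qed.

End Lasso.

End Values.

(* Otherwise conversion unfolds values down to unary powers of 2. *)
Opaque values.

(** * Bounded lassos *)

Section TypeGraph.
Local Open Scope nat_scope.

Lemma lasso_positionS b p i : 0 < p ->
  lasso_position b p i.+1 =
    if (lasso_position b p i).+1 < b + p then (lasso_position b p i).+1 else b.
Proof.
move=> p0; rewrite -addn1 -lasso_positionD // addn1.
case: ltnP => h; first by rewrite lasso_position_id.
have -> : (lasso_position b p i).+1 = b + p.
  by apply/eqP; rewrite eqn_leq h andbT; exact: lasso_position_lt.
by rewrite lasso_positionDp // lasso_position_id // -addn1 leq_add2l.
Qed.

Lemma connect_short (Q : finType) (e : rel Q) x y : connect e x y ->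
  exists r, [/\ path e x r, last x r = y & size r < #|Q|].
Proof.
case/connectP => r er ->; case/shortenP: er => r' er' ur' _; exists r'; split=> //.
by rewrite -[(size r').+1]/(size (x :: r')) -(card_uniqP ur') max_card.
Qed.

Variables (Q : finType) (tau : nat -> Q).

Definition successor : rel Q :=
  fun x y => `[< exists p, tau p = x /\ tau p.+1 = y >].

Definition recurrent (q : Q) : Prop := forall m, exists2 p, m <= p & tau p = q.

(** Each element of the finite type [Q] that is not recurrent is absent from some position on; the
    maximum of these positions works for all. *)
Lemma eventually_recurrent : exists m, forall p, m <= p -> recurrent (tau p).
Proof.
have hN q : exists m, recurrent q \/ forall p, m <= p -> tau p <> q.
  have [h|] := pselect (recurrent q); first by exists 0; left.
  move/existsNP => [m hm]; exists m; right => p mp tp; apply: hm.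
  by exists p.
have [N hN'] := choice hN; exists (\max_q N q) => p hp.
case: (hN' (tau p)) => // /(_ p) []//.
by apply: leq_trans hp; exact: (leq_bigmax (F := N)).
Qed.

Lemma connect_tau m k : connect successor (tau m) (tau (m + k)).
Proof.
elim: k => [|k IH]; first by rewrite addn0.
apply: connect_trans IH _; apply: connect1; apply/asboolP.
by exists (m + k); rewrite addnS.
Qed.

Lemma connect_recurrent m q : recurrent q -> connect successor (tau m) q.
Proof.
by move=> /(_ m)[p mp <-]; rewrite -(subnKC mp); exact: connect_tau.
Qed.

(** Any two recurrent elements are connected by steps of [tau], and a shortest connection has fewer
    than [#|Q|] edges. Concatenating [(size s).+1] such legs gives the tour. *)
Lemma recurrent_tour (s : seq Q) x y :
  {in x :: y :: s, forall q, recurrent q} ->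
  exists r, [/\ path successor x r, last x r = y, {subset s <= x :: r}
    & size r <= (size s).+1 * #|Q|].
Proof.
have conn x' y' : recurrent x' -> recurrent y' -> connect successor x' y'.
  by move=> /(_ 0)[p _ <-]; exact: connect_recurrent.
elim: s x => [|q s IH] x hr.
  have [|r [h1 h2 h3]] := @connect_short _ successor x y.
    by apply: conn; apply: hr; rewrite !inE eqxx ?orbT.
  by exists r; split=> //; rewrite mul1n ltnW.
have [|r1 [h1 h2 h3]] := @connect_short _ successor x q.
  by apply: conn; apply: hr; rewrite !inE eqxx ?orbT.
have [|r2 [k1 k2 k3 k4]] := IH q.
  move=> z; rewrite inE => hz; apply: hr; rewrite !inE.
  move: hz; rewrite inE => /or3P[->|->|->]; by rewrite ?orbT.
exists (r1 ++ r2); split.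
- by rewrite cat_path h1 h2.
- by rewrite last_cat h2.
- have sub : {subset q :: r2 <= x :: r1 ++ r2}.
    move=> z; rewrite inE => /predU1P[->|hz]; last by rewrite inE mem_cat hz !orbT.
    by rewrite -cat_cons mem_cat -h2 mem_last.
  move=> z; rewrite inE => /predU1P[->|/k3 hz]; apply: sub; rewrite // mem_head.
  by [].
- by rewrite size_cat mulSn leq_add // ltnW.
Qed.

(* The loop visits every recurrent element of [Q], so that any property that holds
   infinitely often along [tau] also does along the lasso. *)
Lemma recurrent_lasso : exists u s v,
  let theta k := nth s (u ++ s :: v) (lasso_position (size u) (size v).+1 k) in
  [/\ theta 0 = tau 0,
      forall k, successor (theta k) (theta k.+1),
      forall A : pred Q, (forall m, exists2 p, m <= p & A (tau p)) ->
        forall k, exists2 k', k <= k' & A (theta k'),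
      size u <= #|Q|
    & size (s :: v) <= #|Q|.+1 * #|Q|.+1].
Proof.
have [m hm] := eventually_recurrent.
(* The stem ends at [x], the loop runs from [s = tau m.+1] back to [x], and the same step from [x]
   to [s] both enters and closes the loop. *)
set x := tau m.
have [pu [u1 u2 u3]] := connect_short (connect_tau 0 m).
rewrite add0n -/x in u2.
have sx1 : successor x (tau m.+1) by apply/asboolP; exists m.
set s := tau m.+1 in sx1.
have rs : recurrent s by apply: hm; exact: leqnSn.
have rx : recurrent x by exact: hm.
pose I := [seq q <- enum Q | `[< recurrent q >]].
have [|v [v1 v2 v3 v4]] := @recurrent_tour I s x.
  move=> q; rewrite !inE => /or3P[/eqP->//|/eqP->//|].
  by rewrite mem_filter => /andP[/asboolP].
exists (tau 0 :: pu), s, v; split.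
- by rewrite /lasso_position.
- move=> k; rewrite lasso_positionS //.
  have := lasso_position_lt (size (tau 0 :: pu)) (ltn0Sn (size v)) k.
  set j := lasso_position _ _ k => hj.
  have pw : path successor (tau 0) (pu ++ s :: v).
    by rewrite cat_path u1 u2 /= sx1.
  case: ifP => hj'.
    by have /(pathP s)/(_ j) := pw; apply; move: hj'; rewrite size_cat /= addSn ltnS.
  have Ej : j = size (pu ++ s :: v).
    by move: hj hj'; rewrite size_cat /=; lia.
  rewrite Ej cat_cons -/(cat _ _) -last_nth last_cat /= v2.
  by rewrite nth_cat ltnn subnn.
- move=> A hA k; have [p mp Ap] := hA m.
  have /v3 : tau p \in I by rewrite mem_filter mem_enum andbT; apply/asboolP/hm.
  move=> hin; pose j := index (tau p) (s :: v).
  exists (size (tau 0 :: pu) + (j + k * (size v).+1)).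
    by rewrite mulnS; lia.
  rewrite /lasso_position ltnNge leq_addr /= addKn (addnC j) modnMDl modn_small; last first.
    by rewrite -[(size v).+1]/(size (s :: v)) index_mem.
  rewrite nth_cat ltnNge leq_addr /= addKn.
  by rewrite nth_index.
- by [].
- have : size I <= #|Q| by rewrite cardE size_filter count_size.
  move: v4 => /=; nia.
Qed.

End TypeGraph.

Section BoundedLasso.
Local Open Scope nat_scope.
Variables (AP : finType) (K : kripke AP) (O : nat -> nat) (n c : nat).

Definition codes_of_labels (pi : computation AP) (i : nat) : seq nat :=
  [seq nat_of_ord (enum_rank p) | p <- enum (pi i)].

Lemma lasso_nth T (u : seq T) s v i :
  nth s (u ++ s :: v) (lasso_position (size u) (size v).+1 i) =
  if i < size u then nth s u i else nth s (s :: v) ((i - size u) %% (size v).+1).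
Proof.
rewrite /lasso_position; case: ifP => h; rewrite nth_cat ?h //.
by rewrite ltnNge leq_addr addKn.
Qed.

Let S := 2 ^ n.

Local Notation window := {ffun 'I_c.+1 * 'I_n.+2 -> 'I_S.+1 * 'I_S.+1}.
Local Notation Q := (state K * window)%type.

Let entry (q : Q) a r : nat * nat :=
  let z := q.2 (inord a, inord r) in (nat_of_ord z.1, nat_of_ord z.2).

Variable xi : nat -> state K.
Hypothesis xi_path : is_path xi.

Let W := values O n (codes_of_labels (trace xi)).

(* Windows of n + 2 positions make every operator except until local: X looks one
   position ahead and the truncated discounted until at most n. *)
Let tau p : Q :=
  (xi p, [ffun z : 'I_c.+1 * 'I_n.+2 => (inord (W z.1 (p + z.2)).1, inord (W z.1 (p + z.2)).2)]).

Let entry_tau p a r : a <= c -> r <= n.+1 -> entry (tau p) a r = W a (p + r).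
Proof.
move=> ac rn; have /andP[h1 h2] := values_leq O n (codes_of_labels (trace xi)) a (p + r).
by rewrite /entry ffunE /= !inordK // -surjective_pairing.
Qed.

Let entry_tau0 p a : a <= c -> entry (tau p) a 0 = W a p.
Proof. by move=> ac; rewrite (entry_tau _ ac (leq0n _)) addn0. Qed.

Let card_Q : #|{: Q}| = type_bound #|state K| n c.
Proof. by rewrite card_prod card_ffun !card_prod !card_ord. Qed.

(** Along the lasso of types, the stored values satisfy the same equations as the values of the
    lasso's own label sequence. For until these equations are the one-step equation and fulfilment,
    which have a unique solution by [until_sup_unique]. *)
Lemma bounded_lasso : exists (u : seq (state K)) s v,
  [/\ is_path (lasso u s v),
      values O n (codes_of_labels (trace (lasso u s v))) c 0 =
        values O n (codes_of_labels (trace xi)) c 0,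
      size u <= type_bound #|state K| n c
    & size (s :: v) <= (type_bound #|state K| n c).+1 * (type_bound #|state K| n c).+1].
Proof.
have [u [s [v]]] := recurrent_lasso tau.
set theta := fun k => nth s _ _ => -[th0 thS thA su sv].
rewrite card_Q in su sv.
exists (map fst u), s.1, (map fst v).
have zetaE k : lasso (map fst u) s.1 (map fst v) k = (theta k).1.
  rewrite /theta lasso_nth /lasso !size_map -[s.1 :: _]/(map fst (s :: v)).
  by case: ifP => hk; rewrite (nth_map s) //= ltn_mod.
have ex k : exists p, tau p = theta k /\ tau p.+1 = theta k.+1 by exact/asboolP/thS.
split; [| |by rewrite size_map|by rewrite /= size_map].
  move=> k; rewrite !zetaE; have [p [<- <-]] := ex k; exact: xi_path.
set zeta := lasso _ _ _ in zetaE *.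
set Z := values O n (codes_of_labels (trace zeta)).
(* Each step of the lasso is a step of [tau], where consecutive windows overlap; the entry at offset
   [r] thus moves to offset 0 in [r] steps. *)
have shift a r : a <= c -> r <= n.+1 -> forall k, entry (theta (k + r)) a 0 = entry (theta k) a r.
  move=> ac; elim: r => [|r IH] rn k; first by rewrite addn0.
  rewrite addnS -addSn IH ?(ltnW rn) //; have [p [<- <-]] := ex k.
  by rewrite (entry_tau _ ac rn) (entry_tau _ ac (ltnW rn)) addSnnS.
have main a : a <= c -> forall k, Z a k = entry (theta k) a 0.
  elim/ltn_ind: a => a IH ac k; have [p [Ep _]] := ex k.
  have hw b r : b < a -> r <= n.+1 -> Z b (k + r) = W b (p + r).
    move=> ba rn; have bc : b <= c by exact: leq_trans (ltnW ba) ac.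
    by rewrite (IH b ba bc) (shift b r bc rn) -Ep (entry_tau _ bc rn).
  rewrite -Ep (entry_tau0 _ ac) /Z /W (valuesE _ _ _ _ k) (valuesE _ _ _ _ p).
  apply: eval_step_congr; first exact: hw.
    by rewrite /codes_of_labels /trace zetaE -Ep.
  move=> a5 sel hsel.
  have a0 : 0 < a by case: (a) a5 => //; rewrite arg00.
  have ac1 k' : arg a k' <= c by apply: leq_trans ac; rewrite ltnW ?arg_lt.
  have selS w : (w.1 <= 2 ^ n) && (w.2 <= 2 ^ n) -> sel w <= 2 ^ n.
    by case: hsel => -> /andP[].
  have selW lab b j : sel (values O n lab b j) <= 2 ^ n by exact: (selS _ (values_leq O n lab b j)).
  apply: etrans (values_until O n (codes_of_labels (trace xi)) p a5 hsel).
  apply: etrans (@eq_until_sup _ _ (fun j => sel (entry (theta j) (arg a 1) 0))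
    _ (fun j => sel (entry (theta j) (arg a 2) 0)) k k _ _) _.
  - by move=> j; congr (sel _); exact: (IH _ (arg_lt _ a0) (ac1 _)).
  - by move=> j; congr (sel _); exact: (IH _ (arg_lt _ a0) (ac1 _)).
  rewrite -/W -(entry_tau0 p ac) Ep.
  move: k {p Ep hw}; apply: until_sup_unique.
  - by move=> k; have [p [<- _]] := ex k; rewrite (entry_tau0 _ ac); exact: selW.
  - move=> k; have [p [<- <-]] := ex k.
    rewrite !(entry_tau0 _ ac) !(entry_tau0 _ (ac1 _)).
    rewrite /W (values_until O n _ p a5 hsel) until_sup_unfold; last by move=> j; exact: selW.
    by rewrite -(values_until O n _ p.+1 a5 hsel).
  (* The disjunction holds infinitely often along [tau]: wherever the until value is at least [t],
     some term of the supremum supplies a later position at which the right argument is at least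
     [t]. *)
  - move=> k t.
    apply: (thA (fun q => (t <= sel (entry q (arg a 2) 0)) || (sel (entry q a 0) < t))) => m.
    case: (ltnP (sel (W a m)) t) => htm.
      by exists m; [exact: leqnn | rewrite (entry_tau0 _ ac) htm orbT].
    move: htm; rewrite /W (values_until O n _ m a5 hsel) => /leq_until_sup[i].
    case/leq_until_term => _ hg _; exists (m + i); first exact: leq_addr.
    by rewrite (entry_tau0 _ (ac1 _)) hg.
by rewrite (main c (leqnn c)) th0 (entry_tau0 _ (leqnn c)).
Qed.

End BoundedLasso.

(** * Soundness and convergence of the quantised semantics *)

Section UniformContinuity.
Variables (R : realType) (k : nat) (f : 'rV[R]_k -> R).

Lemma compact_unit_cube : compact (@unit_cube R k).
Proof.
have -> : @unit_cube R k = [set x | forall i, `[0, 1]%classic (x ord0 i)].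
  by apply/seteqP; split=> x /= h i; have := h i; rewrite /= in_itv.
exact: (@rV_compact R k (fun=> `[0, 1]%classic) (fun=> @segment_compact R 0 1)).
Qed.

Lemma unit_cube_uniform_continuity : {within @unit_cube R k, continuous f} ->
  forall e : R, 0 < e -> exists2 d : R, 0 < d &
    forall x y, unit_cube x -> unit_cube y ->
      (forall i, `|x ord0 i - y ord0 i| < d) -> `|f x - f y| < e.
Proof.
move=> /subspace_continuousP fc e e0.
have /near_covering_withinP cov := (compact_near_coveringP _).1 compact_unit_cube.
have : \forall d \near 0^'+, (@unit_cube R k) `<=` (fun x => forall y, unit_cube y ->
      (forall i, `|x ord0 i - y ord0 i| < d) -> `|f x - f y| < e).
  apply: cov => x cx.
  have := fc x cx => /cvgrPdist_lt /(_ (e / 2)); rewrite divr_gt0// => /(_ isT).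
  rewrite near_withinE => /nbhs_ballP[d /= d0 hd].
  (* With [x'] within [d / 2] of [x] and [y] within [z < d / 2] of [x'], both points lie in the ball
     of radius [d] on which [f] stays within [e / 2] of [f x]. *)
  exists (ball x (d / 2), [set z | z < d / 2]).
    split; first by apply: nbhsx_ballx; rewrite divr_gt0.
    by apply: nbhs_right_lt; rewrite divr_gt0.
  move=> [x' z] /= [bx' zd] cx' y cy hy.
  have h1 : `|f x - f x'| < e / 2.
    apply: hd => //; apply: le_ball bx'; lra.
  have h2 : `|f x - f y| < e / 2.
    apply: hd => //; move: bx'; rewrite /ball/= /mx_ball => -[_ bx']; split=> // i j.
    have := bx' i j; rewrite /ball/= !ord1 => b1; have := hy j => b2.
    have := ler_distD (x' ord0 j) (x ord0 j) (y ord0 j); move: b1 b2 zd; lra.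
  have := ler_distD (f x) (f x') (f y); rewrite (distrC (f x') (f x)); lra.
move=> H; have [d [d0 hd]] := filter_ex (filterI (nbhs_right_gt (0 : R)) H).
by exists d => // x y cx cy; exact: (hd x cx y cy).
Qed.

End UniformContinuity.

Section Bounds.
Variables (R : realType) (S : nat).
Hypothesis S0 : (0 < S)%N.

Let S0' : 0 < S%:R :> R.
Proof. by rewrite ltr0n. Qed.

Definition bounds (p : nat * nat) (x : R) : Prop := p.1%:R <= S%:R * x <= p.2%:R.

Lemma bigminP k (x : nat -> R) (y : R) :
  (y <= \big[Num.min/1]_(j < k) x j) <-> (y <= 1 /\ forall j, (j < k)%N -> y <= x j).
Proof.
split=> [/bigmin_geP[h1 h2]|[h1 h2]].
  by split=> // j jk; exact: (h2 (Ordinal jk)).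
by apply/bigmin_geP; split=> // j _; exact: h2.
Qed.

Lemma min_below_attained k f :
  min_below S k f = S \/ exists2 j, (j < k)%N & min_below S k f = f j.
Proof.
elim: k => [|k [IH|[j jk IH]]] /=; first by left.
  rewrite IH; case: (leqP S (f k)) => _; first by left.
  by right; exists k.
rewrite IH; right; case: (leqP (f j) (f k)) => _; [exists j|exists k] => //.
exact: ltnW.
Qed.

Lemma bounds_min_below k (w : nat -> nat * nat) (x : nat -> R) :
  (forall j, (j < k)%N -> bounds (w j) (x j)) ->
  bounds (min_below S k (fun j => (w j).1), min_below S k (fun j => (w j).2))
    (\big[Num.min/1]_(j < k) x j).
Proof.
move=> h; rewrite /bounds /=; apply/andP; split.
  rewrite mulrC -ler_pdivrMr //; apply/bigminP.
  have [h1 h2] := (leq_min_below S k (fun j => (w j).1) _).1 (leqnn _).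
  split; first by rewrite ler_pdivrMr // mul1r ler_nat.
  move=> j jk; rewrite ler_pdivrMr // mulrC; have /andP[h3 _] := h j jk.
  by apply: le_trans h3; rewrite ler_nat h2.
have [b1 b2] := (bigminP k x _).1 (lexx _).
have [->|[j jk ->]] := min_below_attained k (fun j => (w j).2).
  by rewrite -[leRHS]mulr1 ler_pM2l.
have /andP[_ h3] := h j jk; apply: le_trans h3.
by rewrite ler_pM2l // b2.
Qed.

Lemma bounds_min p q x y : bounds p x -> bounds q y ->
  bounds (minn p.1 q.1, minn p.2 q.2) (Num.min x y).
Proof.
move=> /andP[h1 h2] /andP[h3 h4]; rewrite /bounds /=.
have mono : {homo (fun m : nat => m%:R : R) : a b / (a <= b)%N >-> a <= b}.
  by move=> a b; rewrite ler_nat.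
rewrite minr_pMr; last exact: ltW.
rewrite le_min ge_min.
have := mono _ _ (geq_minl p.1 q.1); have := mono _ _ (geq_minr p.1 q.1).
move=> a1 a2; rewrite (le_trans a2 h1) (le_trans a1 h3) /=.
by case: (leqP p.2 q.2) => _; rewrite ?h2 ?h4 ?orbT.
Qed.

Lemma bounds_until (v w : nat -> nat * nat) (x y : nat -> R) i :
  (forall j, bounds (v j) (x j)) -> (forall j, bounds (w j) (y j)) ->
  bounds (until_sup S (fun j => (v j).1) (fun j => (w j).1) i,
          until_sup S (fun j => (v j).2) (fun j => (w j).2) i)
    (sup (range (fun k => Num.min (y (i + k)%N) (\big[Num.min/1]_(j < k) x (i + j)%N)))).
Proof.
move=> hv hw.
pose term k := Num.min (y (i + k)%N) (\big[Num.min/1]_(j < k) x (i + j)%N).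
have ht k : bounds (until_term S (fun j => (v j).1) (fun j => (w j).1) i k,
    until_term S (fun j => (v j).2) (fun j => (w j).2) i k) (term k).
  exact: (bounds_min (hw (i + k)%N)
    (@bounds_min_below k (fun j => v (i + j)%N) (fun j => x (i + j)%N) (fun j _ => hv _))).
have term_le1 k : term k <= 1.
  rewrite ge_min; apply/orP; right; exact: bigmin_le_id.
have hS f g k : (until_term S f g i k <= S)%N by exact: until_term_leq.
apply/andP; split=> /=.
  have [k hk] := sup_below_attained (hS (fun j => (v j).1) (fun j => (w j).1)).
  rewrite /until_sup -hk; have /andP[h1 _] := ht k; apply: le_trans h1 _.
  rewrite ler_pM2l //; apply: ub_le_sup; last by exists k.
  by exists 1 => _ [m _ <-]; exact: term_le1.
rewrite mulrC -ler_pdivlMr //; apply: ge_sup; first by exists (term 0%N); exists 0%N.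
move=> _ [k _ <-]; rewrite ler_pdivlMr // mulrC.
have /andP[_ h1] := ht k; apply: le_trans h1 _; rewrite ler_nat.
exact: (leq_sup_below _ (hS _ _)).
Qed.

Lemma bounds_product e p (a x : R) : 0 <= a -> 0 <= x ->
  `|e%:R - S%:R * a| <= 1 -> bounds p x ->
  bounds ((e.-1 * p.1) %/ S, ((e.+1 * p.2) %/ S).+1)%N (a * x).
Proof.
move=> a0 x0 he /andP[h1 h2]; apply/andP; split=> /=.
  rewrite -(ler_pM2l S0') -natrM mulnC.
  apply: (@le_trans _ _ (e.-1%:R * p.1%:R)); first by rewrite -natrM ler_nat leq_trunc_div.
  (* For [e = 0] the predecessor truncates to 0 and the claim is that [S%:R * a] is nonnegative. *)
  have e1 : e.-1%:R <= S%:R * a.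
    move: he; rewrite ler_distl; case: e => [|e] /= /andP[_ he].
      by rewrite mulr_ge0 // ltW.
    by move: he; rewrite -natr1; lra.
  have -> : S%:R * (S%:R * (a * x)) = (S%:R * a) * (S%:R * x) by ring.
  by apply: ler_pM.
rewrite -(ler_pM2l S0') -natrM mulnC.
apply: (@le_trans _ _ (e.+1%:R * p.2%:R)); last first.
  by rewrite -natrM ler_nat; apply: ltnW; exact: ltn_ceil.
have e1 : S%:R * a <= e.+1%:R.
  by move: he; rewrite ler_distl -natr1 => /andP[he _]; lra.
have -> : S%:R * (S%:R * (a * x)) = (S%:R * a) * (S%:R * x) by ring.
by apply: ler_pM => //; rewrite mulr_ge0 // ltW.
Qed.

Lemma bounds_discounted n (e : nat -> nat) (a : nat -> R)
    (v w : nat -> nat * nat) (x y : nat -> R) i :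
  (forall j, 0 <= a j <= 1) -> (forall j, (n <= j)%N -> a j <= a n) ->
  (forall j, `|(e j)%:R - S%:R * a j| <= 1) ->
  (forall j, 0 <= x j) -> (forall j, 0 <= y j <= 1) ->
  (forall j, bounds (v j) (x j)) -> (forall j, bounds (w j) (y j)) ->
  bounds (discounted_low S n e (fun j => (v j).1) (fun j => (w j).1) i,
          discounted_up S n e (fun j => (v j).2) (fun j => (w j).2) i)
    (sup (range (fun k => Num.min (a k * y (i + k)%N)
       (\big[Num.min/1]_(j < k) (a j * x (i + j)%N))))).
Proof.
move=> a01 an he x0 y01 hv hw.
pose term k := Num.min (a k * y (i + k)%N) (\big[Num.min/1]_(j < k) (a j * x (i + j)%N)).
have a0 j : 0 <= a j by have /andP[] := a01 j.
have y0 j : 0 <= y j by have /andP[] := y01 j.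
pose q (u : nat -> nat * nat) j := (((e j).-1 * (u (i + j)%N).1) %/ S,
  (((e j).+1 * (u (i + j)%N).2) %/ S).+1)%N.
have ht k := bounds_min (bounds_product (a0 k) (y0 _) (he k) (hw (i + k)%N))
   (@bounds_min_below k (q v) (fun j => a j * x (i + j)%N)
     (fun j _ => bounds_product (a0 j) (x0 _) (he j) (hv _))).
have term_le1 k : term k <= 1.
  rewrite ge_min; apply/orP; right; exact: bigmin_le_id.
have term_ge0 k : 0 <= term k.
  rewrite le_min mulr_ge0 //=; apply/(bigminP k (fun j => a j * x (i + j)%N)); split=> // j _; exact: mulr_ge0.
have le_sup k : term k <= sup (range term).
  apply: ub_le_sup; last by exists k.
  by exists 1 => _ [m _ <-]; exact: term_le1.
apply/andP; split=> /=.
  rewrite mulrC -ler_pdivrMr // -/term.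
  suff : forall m, (m <= n)%N -> (max_below m (fun k => minn ((e k).-1 * (w (i + k)%N).1 %/ S)
    (min_below S k (fun j => (e j).-1 * (v (i + j)%N).1 %/ S)))%N)%:R / S%:R <= sup (range term).
    by apply.
  elim=> [_|m IH mn] /=.
    by rewrite mul0r; apply: le_trans (le_sup 0%N).
  case: leqP => _; last exact: (IH (ltnW mn)).
  rewrite ler_pdivrMr // mulrC; have /andP[h1 _] := ht m; apply: le_trans h1 _.
  by rewrite ler_pM2l //; exact: le_sup.
rewrite mulrC -ler_pdivlMr //; apply: ge_sup; first by exists (term 0%N); exists 0%N.
move=> _ [k _ <-]; rewrite ler_pdivlMr // mulrC.
case: (ltnP k n) => hk.
  have /andP[_ h1] := ht k; apply: le_trans h1 _; rewrite ler_nat.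
  apply: leq_trans (leq_maxr _ _).
  exact: (@leq_max_below n (fun k => minn ((e k).+1 * (w (i + k)%N).2 %/ S).+1
    (min_below S k (fun j => ((e j).+1 * (v (i + j)%N).2 %/ S).+1)))%N).
apply: (@le_trans _ _ (e n).+1%:R); last by rewrite ler_nat leq_maxl.
apply: (@le_trans _ _ (S%:R * a n)).
  rewrite ler_pM2l // ge_min; apply/orP; left; apply: le_trans (an k hk).
  by rewrite ler_piMr //; have /andP[] := y01 (i + k)%N.
by have := he n; rewrite ler_distl -natr1 => /andP[he1 _]; lra.
Qed.

Lemma bounds_clip p x : 0 <= x <= 1 -> bounds p x -> bounds (minn S p.1, minn S p.2) x.
Proof.
move=> /andP[x0 x1] /andP[h1 h2]; apply/andP; split=> /=.
  by apply: le_trans h1; rewrite ler_nat geq_minr.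
by case: leqP => _ //; rewrite -[leRHS]mulr1 ler_pM2l.
Qed.

End Bounds.

Section Soundness.
Variables (R : realType) (AP : finType).
Variables (D : set (nat -> R)) (F : forall k : nat, set ('rV[R]_k -> R)).
Hypothesis hD : forall eta : nat -> R, D eta -> discounting eta.
Hypothesis hF : forall k : nat, @F k `<=` @Fmc R k.
Implicit Types (phi : formula AP D F) (pi : computation AP).

Lemma suffix_atD pi i j : suffix_at (suffix_at pi i) j = suffix_at pi (i + j).
Proof. by apply: funext => k; rewrite /suffix_at addnA. Qed.

Lemma sup_range01 (x : nat -> R) : (forall k, 0 <= x k <= 1) -> 0 <= sup (range x) <= 1.
Proof.
move=> h; apply/andP; split.
  have /andP[x0 _] := h 0%N; apply: le_trans x0 _; apply: ub_le_sup; last by exists 0%N.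
  by exists 1 => _ [k _ <-]; have /andP[] := h k.
apply: ge_sup; first by exists (x 0%N); exists 0%N.
by move=> _ [k _ <-]; have /andP[] := h k.
Qed.

Lemma min_bigmin01 k (y : R) (x : nat -> R) : 0 <= y -> (forall j, 0 <= x j) ->
  0 <= Num.min y (\big[Num.min/1]_(j < k) x j) <= 1.
Proof.
move=> y0 x0; apply/andP; split.
  by rewrite le_min y0; apply/(bigminP k x); split.
by rewrite ge_min; apply/orP; right; exact: bigmin_le_id.
Qed.

Lemma truth01 phi pi : 0 <= truth pi phi <= 1.
Proof.
elim: phi pi => [|p|phi IH|phi1 IH1 phi2 IH2|phi IH|phi1 IH1 phi2 IH2
  |eta Deta phi1 IH1 phi2 IH2|k f Ff args IH] pi /=.
- by rewrite ler01 lexx.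
- by case: (_ \in _); rewrite ?ler01 lexx.
- by have /andP[h1 h2] := IH pi; apply/andP; split; lra.
- have /andP[h1 h2] := IH1 pi; have /andP[h3 h4] := IH2 pi.
  by rewrite le_min ge_min h1 h3 h2.
- exact: IH.
- apply: sup_range01 => k.
  apply: (@min_bigmin01 k _ (fun j => truth (suffix_at pi j) phi1)).
    by have /andP[] := IH2 (suffix_at pi k).
  by move=> j; have /andP[] := IH1 (suffix_at pi j).
- have [eta01 _ _] := hD Deta; apply: sup_range01 => k.
  have eta0 j : 0 <= eta j by have /andP[] := eta01 j.
  apply: (@min_bigmin01 k _ (fun j => eta j * truth (suffix_at pi j) phi1)).
    by apply: mulr_ge0 => //; have /andP[] := IH2 (suffix_at pi k).
  by move=> j; apply: mulr_ge0 => //; have /andP[] := IH1 (suffix_at pi j).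
- have [h _ _] := hF Ff; apply: h => i; rewrite mxE; exact: IH.
Qed.

Lemma truth_until phi1 phi2 pi i : truth (suffix_at pi i) (FUntil phi1 phi2) =
  sup (range (fun k => Num.min (truth (suffix_at pi (i + k)%N) phi2)
    (\big[Num.min/1]_(j < k) truth (suffix_at pi (i + j)%N) phi1))).
Proof.
rewrite /=; congr sup; apply: eq_imagel => k _; rewrite suffix_atD.
by congr Num.min; apply: eq_bigr => j _; rewrite suffix_atD.
Qed.

Lemma truth_discounted eta (Deta : D eta) phi1 phi2 pi i :
  truth (suffix_at pi i) (FDUntil Deta phi1 phi2) =
  sup (range (fun k => Num.min (eta k * truth (suffix_at pi (i + k)%N) phi2)
    (\big[Num.min/1]_(j < k) (eta j * truth (suffix_at pi (i + j)%N) phi1)))).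
Proof.
rewrite /=; congr sup; apply: eq_imagel => k _; rewrite suffix_atD.
by congr Num.min; apply: eq_bigr => j _; rewrite suffix_atD.
Qed.

Lemma names_real_scaled nu (x : R) n :
  names_real nu x -> `|(nu n)%:R - (2 ^ n)%N%:R * x| <= 1.
Proof.
move=> /(_ n); rewrite /dyadic; have s0 : 0 < (2 ^+ n : R) by rewrite exprn_gt0.
rewrite natrX -(ler_pM2l s0) mulfV ?gt_eqF //.
rewrite -{1}(gtr0_norm s0) -normrM mulrBr mulrCA mulfV ?gt_eqF // mulr1 //.
Qed.

Section Step.
Variables (O : nat -> nat) (n : nat) (lab : nat -> seq nat).
Local Notation S := (2 ^ n)%N.
Local Notation V := (values O n lab).

Lemma arg_code s k : arg (seq_code s) k = nth 0%N s k.
Proof. by rewrite /arg seq_codeK. Qed.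

Lemma clip_values a b : (a <= S)%N && (b <= S)%N -> (minn S a, minn S b) = (a, b).
Proof. by case/andP => /minn_idPr-> /minn_idPr->. Qed.

Lemma values_true i : V (seq_code [:: 0%N]) i = (S, S).
Proof.
rewrite [LHS]valuesE; move: (values O n lab) (values_leq O n lab) => W leW.
by rewrite /eval_step !arg_code /= !minnn.
Qed.

Lemma values_atom m i : V (seq_code [:: 1%N; m]) i = if m \in lab i then (S, S) else (0, 0)%N.
Proof.
rewrite [LHS]valuesE; move: (values O n lab) (values_leq O n lab) => W leW.
by rewrite /eval_step !arg_code /=; case: ifP; rewrite /= ?minnn ?minn0.
Qed.

Lemma values_not a i : V (seq_code [:: 2%N; a]) i = (S - (V a i).2, S - (V a i).1)%N.
Proof.
rewrite [LHS]valuesE; move: (values O n lab) (values_leq O n lab) => W leW.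
rewrite /eval_step !arg_code /=; rewrite clip_values //.
by rewrite /= !leq_subr.
Qed.

Lemma values_and a b i : V (seq_code [:: 3%N; a; b]) i =
  (minn (V a i).1 (V b i).1, minn (V a i).2 (V b i).2).
Proof.
rewrite [LHS]valuesE; move: (values O n lab) (values_leq O n lab) => W leW.
rewrite /eval_step !arg_code /=; rewrite clip_values //.
by have /andP[h1 h2] := leW a i; rewrite !geq_min h1 h2.
Qed.

Lemma values_next a i : V (seq_code [:: 4%N; a]) i = V a i.+1.
Proof.
rewrite [LHS]valuesE; move: (values O n lab) (values_leq O n lab) => W leW.
rewrite /eval_step !arg_code /=; rewrite clip_values -?surjective_pairing //; exact: leW.
Qed.

Lemma values_until_code a b i : V (seq_code [:: 5%N; a; b]) i =
  (until_sup S (fun j => (V a j).1) (fun j => (V b j).1) i,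
   until_sup S (fun j => (V a j).2) (fun j => (V b j).2) i).
Proof.
rewrite [LHS]valuesE; move: (values O n lab) (values_leq O n lab) => W leW.
rewrite /eval_step !arg_code /=; rewrite clip_values //.
by apply/andP; split; apply: sup_below_leq => k; exact: until_term_leq.
Qed.

Lemma values_discounted c a b i : V (seq_code [:: 6%N; c; a; b]) i =
  let e k := O (pair_code c (pair_code k n)) in
  (minn S (discounted_low S n e (fun j => (V a j).1) (fun j => (V b j).1) i),
   minn S (discounted_up S n e (fun j => (V a j).2) (fun j => (V b j).2) i)).
Proof.
rewrite [LHS]valuesE; move: (values O n lab) (values_leq O n lab) => W leW.
by rewrite /eval_step !arg_code.
Qed.

Lemma values_operator c s i : V (seq_code [:: 7%N, c & s]) i =
  let q t := O (pair_code c (pair_code (pair_code n (seq_code t)) n)) in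
  (minn S (q [seq (V a i).1 | a <- s]).-1, minn S (q [seq (V a i).2 | a <- s]).+1).
Proof.
rewrite [LHS]valuesE; move: (values O n lab) (values_leq O n lab) => W leW.
by rewrite /eval_step !arg_code seq_codeK /= drop0.
Qed.

End Step.

Lemma map_codom k T (g : nat -> T) (a : 'I_k -> nat) : map g (codom a) = codom (g \o a).
Proof. by rewrite /codom /image_mem -map_comp. Qed.

Lemma operator_query O n k (f : 'rV[R]_k -> R) c (m : 'I_k -> nat) :
  names_operator (channel O c) f -> (forall i, (m i <= 2 ^ n)%N) ->
  `|(O (pair_code c (pair_code (pair_code n (seq_code (codom m))) n)))%:R
    - (2 ^ n)%N%:R * f (\row_i dyadic R (m i) n)| <= 1.
Proof. by move=> hf hm; exact: (names_real_scaled n (hf n m hm)). Qed.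

Lemma dyadic01 m n : (m <= 2 ^ n)%N -> 0 <= dyadic R m n <= 1.
Proof.
move=> h; rewrite /dyadic divr_ge0 ?ler0n ?exprn_ge0 //= ler_pdivrMr ?exprn_gt0 //.
by rewrite mul1r -natrX ler_nat.
Qed.

Theorem truth_bounds O phi c : codes_formula O phi c -> forall n pi i,
  bounds (2 ^ n) (values O n (codes_of_labels pi) c i) (truth (suffix_at pi i) phi).
Proof.
move=> hc n pi; have S0 : (0 < 2 ^ n)%N by rewrite expn_gt0.
elim: phi c hc => [|p|phi IH|phi1 IH1 phi2 IH2|phi IH|phi1 IH1 phi2 IH2
  |eta Deta phi1 IH1 phi2 IH2|k f Ff args IH] c /=.
- by move=> -> i; rewrite values_true /bounds mulr1 /= !lexx.
- move=> -> i; rewrite values_atom /codes_of_labels.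
  have -> : (nat_of_ord (enum_rank p) \in [seq nat_of_ord (enum_rank q) | q <- enum (pi i)])
     = (p \in pi i).
    have inj : injective (fun q : AP => nat_of_ord (enum_rank q)).
      by move=> x y /ord_inj; exact: enum_rank_inj.
    by rewrite (mem_map inj) mem_enum.
  rewrite /bounds /suffix_at addn0; case: (p \in pi i) => /=.
    by rewrite mulr1 lexx.
  by rewrite mulr0 lexx.
- move=> [a ha ->] i; rewrite values_not; have /andP[h1 h2] := IH a ha i.
  have /andP[l1 l2] := values_leq O n (codes_of_labels pi) a i.
  by rewrite /bounds /= !natrB // mulrBr mulr1; apply/andP; split; lra.
- move=> [a [b [ha hb ->]]] i; rewrite values_and; apply: bounds_min => //.
    exact: IH1.
  exact: IH2.
- move=> [a ha ->] i; rewrite values_next suffix_atD addn1; exact: IH.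
- move=> [a [b [ha hb ->]]] i; rewrite values_until_code.
  have := bounds_until S0 i (IH1 a ha) (IH2 b hb).
  by rewrite -truth_until.
- move=> [ch [a [b [heta ha hb ->]]]] i; rewrite values_discounted /=.
  have [eta01 etad _] := hD Deta.
  apply: (bounds_clip S0 (p := (_, _)) (truth01 (FDUntil Deta phi1 phi2) (suffix_at pi i))).
  have an j : (n <= j)%N -> eta j <= eta n.
    by rewrite leq_eqVlt => /predU1P[->//|/etad/ltW].
  have t0 phi j : 0 <= truth (suffix_at pi j) phi by have /andP[] := truth01 phi (suffix_at pi j).
  have he j : `|(O (pair_code ch (pair_code j n)))%:R - (2 ^ n)%N%:R * eta j| <= 1.
    exact: (names_real_scaled n (heta j)).
  have := bounds_discounted S0 i eta01 an he (t0 phi1)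
    (fun j => truth01 phi2 (suffix_at pi j)) (IH1 a ha) (IH2 b hb).
  by rewrite -(truth_discounted Deta).
- move=> [ch [a [hf ha ->]]] i; rewrite values_operator /=.
  have [_ fmono _] := hF Ff.
  apply: (bounds_clip S0 (p := (_, _)) (truth01 (FOp Ff args) (suffix_at pi i))).
  have leS j := values_leq O n (codes_of_labels pi) (a j) i.
  have l1 j : ((values O n (codes_of_labels pi) (a j) i).1 <= 2 ^ n)%N.
    by have /andP[] := leS j.
  have l2 j : ((values O n (codes_of_labels pi) (a j) i).2 <= 2 ^ n)%N.
    by have /andP[] := leS j.
  rewrite !map_codom.
  have := operator_query (m := (fun b => (values O n (codes_of_labels pi) b i).1) \o a) hf l1.
  have := operator_query (m := (fun b => (values O n (codes_of_labels pi) b i).2) \o a) hf l2.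
  set o2 := O _; set o1 := O _; set x2 := \row_i _; set x1 := \row_i _.
  rewrite [truth _ _]/=; set x := \row_i truth _ _.
  have cx1 : unit_cube x1 by move=> j; rewrite mxE; apply: dyadic01; exact: l1.
  have cx2 : unit_cube x2 by move=> j; rewrite mxE; apply: dyadic01; exact: l2.
  have cx : unit_cube x by move=> j; rewrite mxE; exact: truth01.
  have s0 : 0 < (2 ^+ n : R) by rewrite exprn_gt0.
  have f1 : f x1 <= f x.
    apply: fmono => // j; rewrite !mxE /dyadic ler_pdivrMr // mulrC -natrX.
    by have /andP[] := IH j (a j) (ha j) i.
  have f2 : f x <= f x2.
    apply: fmono => // j; rewrite !mxE /dyadic ler_pdivlMr // mulrC -natrX.
    by have /andP[] := IH j (a j) (ha j) i.
  have S0' : 0 < (2 ^ n)%N%:R :> R by rewrite ltr0n.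
  rewrite !ler_distl /bounds; move: (_%:R) S0' => T T0.
  move=> /andP[b1 b2] /andP[b3 b4]; apply/andP; split=> /=; last first.
    rewrite -natr1; apply: (@le_trans _ _ (T * f x2)); first by rewrite ler_pM2l.
    lra.
  apply: (@le_trans _ _ (T * f x1)); last by rewrite ler_pM2l.
  (* This settles the case where the oracle answers 0, in which the predecessor does not
     decrease. *)
  have : 0 <= f x1 by have [q01 _ _] := hF Ff; have /andP[] := q01 x1 cx1.
  move: b3 b4; case: (o1) => [|o] /= b3 b4 fx.
    by rewrite mulr_ge0 // ltW.
  move: b3 b4; rewrite -natr1; lra.
Qed.

End Soundness.

(** * Convergence: how much each connective widens the enclosures *)

Section Gaps.
Local Open Scope nat_scope.
Variables (S g : nat).

Lemma gap_min_below k f f' : (forall j, j < k -> f' j <= f j + g) ->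
  min_below S k f' <= min_below S k f + g.
Proof.
elim: k => [|k IH] h /=; first exact: leq_addr.
have := h k (leqnn _); have : min_below S k f' <= min_below S k f + g.
  by apply: IH => j jk; apply: h; exact: ltnW.
lia.
Qed.

Lemma gap_max_below k f f' : (forall j, j < k -> f' j <= f j + g) ->
  max_below k f' <= max_below k f + g.
Proof.
elim: k => [|k IH] h /=; first exact: leq_addr.
have := h k (leqnn _); have : max_below k f' <= max_below k f + g.
  by apply: IH => j jk; apply: h; exact: ltnW.
lia.
Qed.

Lemma gap_minn a a' b b' : a' <= a + g -> b' <= b + g -> minn a' b' <= minn a b + g.
Proof. lia. Qed.

(** Minima and suprema do not increase a uniform gap, so until needs no horizon here in spite of its
    infinitely many terms. *)
Lemma gap_until (v w : nat -> nat * nat) i :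
  (forall j, (v j).2 <= (v j).1 + g) -> (forall j, (w j).2 <= (w j).1 + g) ->
  until_sup S (fun j => (v j).2) (fun j => (w j).2) i <=
  until_sup S (fun j => (v j).1) (fun j => (w j).1) i + g.
Proof.
move=> hv hw; apply: sup_below_leq => k.
apply: leq_trans (_ : until_term S (fun j => (v j).1) (fun j => (w j).1) i k + g <= _).
  by apply: gap_minn => //; apply: gap_min_below.
rewrite leq_add2r; apply: leq_sup_below => j; exact: until_term_leq.
Qed.

End Gaps.

Section Gaps.
Local Open Scope nat_scope.
Variables (S g : nat).
Hypothesis S0 : 0 < S.

(** Replacing [e.-1] by [e.+1] costs at most [2 * l <= 2 * S], and widening [l] by [g] costs at most
    [e.+1 * g <= 3 * S * g]. After division by [S] these become [2 + 3 * g]; the rest of the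
    constant covers the rounding. *)
Lemma gap_product e l h : h <= l + g -> l <= S -> e <= S.+1 ->
  ((e.+1 * h) %/ S).+1 <= (e.-1 * l) %/ S + (3 * g + 4).
Proof.
move=> hl lS eS.
have : e.+1 * h <= (2 + 3 * g) * S + e.-1 * l.
  apply: leq_trans (leq_mul (leqnn e.+1) hl) _; case: e eS => [|e] /= eS; nia.
move=> /(leq_div2r S); rewrite divnMDl //; lia.
Qed.

Lemma gap_discounted n e (v w : nat -> nat * nat) i :
  (forall j, (v j).2 <= (v j).1 + g) -> (forall j, (w j).2 <= (w j).1 + g) ->
  (forall j, (v j).1 <= S) -> (forall j, (w j).1 <= S) -> (forall j, e j <= S.+1) ->
  discounted_up S n e (fun j => (v j).2) (fun j => (w j).2) i <=
  discounted_low S n e (fun j => (v j).1) (fun j => (w j).1) i + (3 * g + 4 + (e n).+1).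
Proof.
move=> hv hw vS wS eS; rewrite /discounted_up geq_max; apply/andP; split; first by lia.
rewrite addnA; apply: leq_trans (leq_addr _ _); apply: gap_max_below => k _.
apply: gap_minn; first exact: gap_product.
by apply: gap_min_below => j _; exact: gap_product.
Qed.

End Gaps.

Section Convergence.
Variables (R : realType) (AP : finType).
Variables (D : set (nat -> R)) (F : forall k : nat, set ('rV[R]_k -> R)).
Hypothesis hD : forall eta : nat -> R, D eta -> discounting eta.
Hypothesis hF : forall k : nat, @F k `<=` @Fmc R k.
Implicit Types (phi : formula AP D F) (pi : computation AP).

Lemma eventually_leq_expn2 (x : R) : exists N, forall n, (N <= n)%N -> x <= (2 ^ n)%N%:R.
Proof.
exists (Num.trunc x).+1 => n hn.
have [x0|/ltW x0] := leP 0 x; last exact: le_trans x0 (ler0n _ _).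
have /andP[_ /ltW h] := truncn_itv x0; apply: le_trans h _.
by rewrite ler_nat; apply: leq_trans hn _; apply: ltnW; exact: ltn_expl.
Qed.

Lemma gap_trunc (x : R) a b : 0 <= x -> b%:R <= a%:R + x -> (b <= a + Num.trunc x)%N.
Proof.
move=> x0 h; rewrite -leq_subLR truncn_ge_nat //.
have [ba|/ltnW ab] := leqP b a; first by rewrite (eqP ba).
by rewrite natrB // lerBlDl.
Qed.

Section Formula.
Variable O : nat -> nat.

(** The gap is relative to the scale and uniform in the computation and the position, so that one
    precision suits all paths at once. *)
Definition gap_le n c (x : R) := forall pi i,
  (values O n (codes_of_labels pi) c i).2%:R <=
  (values O n (codes_of_labels pi) c i).1%:R + x * (2 ^ n)%N%:R.

Lemma gap_le_nat n c x : 0 <= x -> gap_le n c x -> forall pi i,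
  ((values O n (codes_of_labels pi : nat -> seq nat) c i).2 <=
  (values O n (codes_of_labels (AP := AP) pi) c i).1 + Num.trunc (x * (2 ^ n)%N%:R))%N.
Proof. by move=> x0 h pi i; apply: gap_trunc (h pi i); rewrite mulr_ge0. Qed.

Lemma nat_gap_le n c x (g : nat) : g%:R <= x * (2 ^ n)%N%:R ->
  (forall pi i, ((values O n (codes_of_labels pi) c i).2 <=
    (values O n (codes_of_labels pi) c i).1 + g)%N) -> gap_le n c x.
Proof.
move=> gx h pi i; apply: (@le_trans _ _ ((values O n (codes_of_labels pi) c i).1 + g)%N%:R).
  by rewrite ler_nat.
by rewrite natrD lerD2l.
Qed.

Lemma trunc_scaled_le n (x : R) : 0 <= x ->
  (Num.trunc (x * (2 ^ n)%N%:R))%:R <= x * (2 ^ n)%N%:R.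
Proof. by move=> x0; rewrite truncn_le mulr_ge0. Qed.

Theorem values_converge phi c : codes_formula O phi c ->
  forall x : R, 0 < x -> exists N, forall n, (N <= n)%N -> gap_le n c x.
Proof.
elim: phi c => [|p|phi IH|phi1 IH1 phi2 IH2|phi IH|phi1 IH1 phi2 IH2
  |eta Deta phi1 IH1 phi2 IH2|k f Ff args IH] c /=.
- move=> -> x x0; exists 0%N => n _ pi i; rewrite values_true /=.
  by rewrite lerDl mulr_ge0 // ltW.
- move=> -> x x0; exists 0%N => n _ pi i; rewrite values_atom.
  by case: (_ \in _) => /=; rewrite lerDl mulr_ge0 // ltW.
- move=> [a ha ->] x x0; have [N hN] := IH a ha x x0; exists N => n Nn.
  have h := gap_le_nat (ltW x0) (hN n Nn).
  apply: (nat_gap_le (trunc_scaled_le n (ltW x0))) => pi i; rewrite values_not /=.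
  have := h pi i; have /andP[] := values_leq O n (codes_of_labels pi) a i.
  move: (2 ^ n)%N (values _ _ _ _ _).1 (values _ _ _ _ _).2 (Num.trunc _); lia.
- move=> [a [b [ha hb ->]]] x x0; have [N hN] := IH1 a ha x x0.
  have [M hM] := IH2 b hb x x0; exists (maxn N M) => n; rewrite geq_max => /andP[Nn Mn].
  have h := gap_le_nat (ltW x0) (hN n Nn); have h' := gap_le_nat (ltW x0) (hM n Mn).
  apply: (nat_gap_le (trunc_scaled_le n (ltW x0))) => pi i; rewrite values_and /=.
  by apply: gap_minn.
- move=> [a ha ->] x x0; have [N hN] := IH a ha x x0; exists N => n Nn pi i.
  by rewrite values_next; exact: hN.
- move=> [a [b [ha hb ->]]] x x0; have [N hN] := IH1 a ha x x0.
  have [M hM] := IH2 b hb x x0; exists (maxn N M) => n; rewrite geq_max => /andP[Nn Mn].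
  have h := gap_le_nat (ltW x0) (hN n Nn); have h' := gap_le_nat (ltW x0) (hM n Mn).
  apply: (nat_gap_le (trunc_scaled_le n (ltW x0))) => pi i; rewrite values_until_code /=.
  by apply: gap_until.
- move=> [ch [a [b [heta ha hb ->]]]] x x0.
  have [eta01 etad etac] := hD Deta.
  (* In units of the scale, [3 * g] contributes [x / 4], the tail after the horizon another [x / 4],
     and the constant 4 with the two units from bounding [(e n).+1] makes 6, which is at most
     [x / 4] once the scale reaches [24 / x]. *)
  have y0 : 0 < x / 12 by rewrite divr_gt0.
  have [N1 hN1] := IH1 a ha _ y0; have [N2 hN2] := IH2 b hb _ y0.
  have [N3 hN3] := eventually_leq_expn2 (24 / x).
  have [N4 _ hN4] : \forall n \near \oo, eta n <= x / 4.
    move/cvgrPdist_le : etac => /(_ (x / 4)) /=; rewrite divr_gt0 // => /(_ isT).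
    apply: filterS => n; rewrite sub0r normrN; exact: le_trans (ler_norm _).
  exists (maxn (maxn N1 N2) (maxn N3 N4)) => n; rewrite !geq_max => /andP[/andP[n1 n2] /andP[n3 n4]].
  have h1 := gap_le_nat (ltW y0) (hN1 n n1); have h2 := gap_le_nat (ltW y0) (hN2 n n2).
  have tr := trunc_scaled_le n (ltW y0).
  move: h1 h2 tr; set g := Num.trunc _ => h1 h2 tr.
  have he j : `|(O (pair_code ch (pair_code j n)))%:R - (2 ^ n)%N%:R * eta j| <= 1.
    exact: (names_real_scaled n (heta j)).
  pose e j := O (pair_code ch (pair_code j n)).
  have S0 : (0 < 2 ^ n)%N by rewrite expn_gt0.
  have S0' : 0 < (2 ^ n)%N%:R :> R by rewrite ltr0n.
  have eS j : (e j <= (2 ^ n).+1)%N.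
    rewrite -(ler_nat R) -natr1; have := he j; rewrite ler_distl => /andP[_].
    have /andP[_ e1] := eta01 j.
    have : (2 ^ n)%N%:R * eta j <= (2 ^ n)%N%:R by rewrite ler_piMr // ltW.
    by rewrite /e; move: (O _)%:R ((2 ^ n)%N%:R * eta j) => A B; lra.
  apply: (@nat_gap_le _ _ _ (3 * g + 4 + (e n).+1)); last first.
    move=> pi i; rewrite values_discounted /=.
    have vS c' j : ((values O n (codes_of_labels pi) c' j).1 <= 2 ^ n)%N.
      by have /andP[] := values_leq O n (codes_of_labels pi) c' j.
    have := @gap_discounted (2 ^ n) g S0 n e _ _ i (h1 pi) (h2 pi) (vS a) (vS b) eS.
    by rewrite /e; lia.
  rewrite (natrD _ (3 * g + 4)%N) (natrD _ (3 * g)%N) natrM -[(e n).+1%:R]natr1.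
  have := he n; rewrite -/(e n) ler_distl => /andP[_].
  have := hN3 n n3; rewrite ler_pdivrMr // => q3.
  have q4 : (2 ^ n)%N%:R * eta n <= (2 ^ n)%N%:R * (x / 4).
    by rewrite ler_pM2l //; apply: hN4.
  move: q3 q4 tr; move: ((2 ^ n)%N%:R) (eta n) => T E q3 q4 tr.
  have -> : x * T = T * (x / 4) * 4 by field.
  have E1 : x / 12 * T = T * (x / 4) / 3 by field.
  have E2 : T * x = T * (x / 4) * 4 by field.
  move: q3 q4 tr; rewrite E1 E2; move: (T * (x / 4)) (T * E) => A B; lra.
- move=> [ch [a [hf ha ->]]] x x0.
  have [f01 fmono fcont] := hF Ff.
  (* Half of [x] is for the variation of [f] between the two grid points. The other half covers the
     four units lost to the two query errors and the shifts by 1, whence [8 / x]. Taking [d / 2] for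
     the arguments makes their distance strictly less than [d]. *)
  have x2 : 0 < x / 2 by rewrite divr_gt0.
  have [d d0 hd] := unit_cube_uniform_continuity fcont x2.
  have d2 : 0 < d / 2 by rewrite divr_gt0.
  have /choice[N hN] : forall j, exists N, forall n, (N <= n)%N -> gap_le n (a j) (d / 2).
    by move=> j; exact: IH.
  have [M hM] := eventually_leq_expn2 (8 / x).
  exists (maxn M (\max_j N j)) => n; rewrite geq_max => /andP[Mn Nn] pi i.
  have S0 : (0 < 2 ^ n)%N by rewrite expn_gt0.
  have S0' : 0 < (2 ^ n)%N%:R :> R by rewrite ltr0n.
  have s0 : 0 < (2 ^+ n : R) by rewrite exprn_gt0.
  rewrite values_operator /= !map_codom.
  have leS j := values_leq O n (codes_of_labels pi) (a j) i.
  have l1 j : ((values O n (codes_of_labels pi) (a j) i).1 <= 2 ^ n)%N.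
    by have /andP[] := leS j.
  have l2 j : ((values O n (codes_of_labels pi) (a j) i).2 <= 2 ^ n)%N.
    by have /andP[] := leS j.
  have := operator_query (m := (fun b => (values O n (codes_of_labels pi) b i).1) \o a) hf l1.
  have := operator_query (m := (fun b => (values O n (codes_of_labels pi) b i).2) \o a) hf l2.
  set o2 := O _; set o1 := O _; set y2 := \row_i _; set y1 := \row_i _.
  have cy1 : unit_cube y1 by move=> j; rewrite mxE; apply: dyadic01; exact: l1.
  have cy2 : unit_cube y2 by move=> j; rewrite mxE; apply: dyadic01; exact: l2.
  have : `|f y2 - f y1| < x / 2.
    apply: hd => // j; rewrite !mxE /dyadic /= -mulrBl normrM [`|_^-1|]gtr0_norm ?invr_gt0 //.
    rewrite ltr_pdivrMr // -natrX.
    have /andP[b1 b2] := truth_bounds hD hF (ha j) n pi i.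
    have b3 : (N j <= n)%N by apply: leq_trans Nn; exact: (leq_bigmax (F := N)).
    have := hN j n b3 pi i => b4.
    rewrite ger0_norm; last by rewrite subr_ge0 (le_trans b1 b2).
    have : d / 2 * (2 ^ n)%N%:R < d * (2 ^ n)%N%:R by rewrite ltr_pM2r //; lra.
    lra.
  rewrite ltr_distl => /andP[_ ff].
  have := hM n Mn; rewrite ler_pdivrMr // => q.
  rewrite !ler_distl => /andP[_ b2] /andP[b3 _].
  (* If the lower bound is clipped it equals the scale, and the clipped upper bound cannot exceed
     it. *)
  have [hc|/ltnW hc] := leqP (2 ^ n) o1.-1.
    by apply: ler_wpDr; [rewrite mulr_ge0 // ltW | rewrite ler_nat geq_minl].
  rewrite ?(minn_idPr hc).
  apply: (@le_trans _ _ o2.+1%:R); first by rewrite ler_nat geq_minr.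
  have p1 : o1%:R <= o1.-1%:R + 1 :> R by rewrite natr1 ler_nat; lia.
  have : (2 ^ n)%N%:R * f y2 <= (2 ^ n)%N%:R * (f y1 + x / 2) by rewrite ler_pM2l // ltW.
  rewrite -natr1 mulrDr.
  move: q b2 b3; move: ((2 ^ n)%N%:R) (f y2) (f y1) => T A B q b2 b3.
  have -> : T * (x / 2) = T * x / 2 by field.
  rewrite (mulrC x T); move: q b2 b3; move: (T * x) (T * A) (T * B) => X Y Z; lra.
Qed.

End Formula.
End Convergence.

(** * Correctness of the search *)

Section LassoCodes.
Local Open Scope nat_scope.
Variables (AP : finType) (K : kripke AP).
Implicit Types (u v : seq (state K)) (s : state K).

Definition rank s : nat := nat_of_ord (enum_rank s).

Lemma rank_inj : injective rank.
Proof. by move=> x y /ord_inj; exact: enum_rank_inj. Qed.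

Definition kripke_table : seq (seq nat * seq nat) :=
  [seq ([seq rank t | t <- enum (state K) & trans s t],
        [seq nat_of_ord (enum_rank p) | p <- enum (label s)]) | s <- enum (state K)].

Lemma kripke_dataE : kripke_data (kripke_code K) = kripke_table.
Proof.
rewrite /kripke_data /kripke_code seq_codeK -map_comp; apply: eq_map => s /=.
by rewrite pair_codeK /= !seq_codeK.
Qed.

Lemma size_kripke_table : size kripke_table = #|state K|.
Proof. by rewrite size_map -cardE. Qed.

Lemma nth_kripke_table s : nth ([::], [::]) kripke_table (rank s) =
  ([seq rank t | t <- enum (state K) & trans s t],
   [seq nat_of_ord (enum_rank p) | p <- enum (label s)]).
Proof. by rewrite (nth_map s) -?cardE ?ltn_ord // nth_enum_rank. Qed.

Lemma mem_successors s t :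
  (rank t \in (nth ([::], [::]) kripke_table (rank s)).1) = trans s t.
Proof. by rewrite nth_kripke_table (mem_map rank_inj) mem_filter mem_enum andbT. Qed.

Lemma lasso_stateE u s v i :
  lasso_state (map rank u) (map rank (s :: v)) i = rank (lasso u s v i).
Proof.
have := lasso_position_lt (size u) (ltn0Sn (size v)) i.
rewrite /lasso_state -map_cat !size_map => h.
by rewrite (nth_map s) ?size_cat // lasso_nth.
Qed.

Lemma lasso_state_position (x y : seq nat) i : 0 < size y ->
  lasso_state x y (lasso_position (size x) (size y) i) = lasso_state x y i.
Proof.
by move=> y0; rewrite /lasso_state (lasso_position_id y0 (lasso_position_lt _ y0 _)).
Qed.

Lemma lasso_validE u s v :
  lasso_valid kripke_table (map rank u) (map rank (s :: v)) <-> is_path (lasso u s v).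
Proof.
set x := map rank u; set y := map rank (s :: v); split=> [/andP[y0 /all_belowP h]|h]; last first.
  apply/andP; split=> //; apply/all_belowP => i _.
  by rewrite !lasso_stateE mem_successors; exact: h.
move=> i; rewrite -mem_successors -!lasso_stateE -/x -/y.
have := h _ (lasso_position_lt (size x) y0 i); rewrite lasso_state_position //.
by rewrite -(lasso_state_position x _.+1 y0) -addn1 lasso_positionD // addn1 lasso_state_position.
Qed.

Lemma rank_surj (x : seq nat) : {in x, forall a, a < #|state K|} -> exists u, map rank u = x.
Proof.
elim: x => [|a x IH] h; first by exists [::].
have [|u ux] := IH; first by move=> b bx; apply: h; rewrite inE bx orbT.
have lt : a < #|state K| by apply: h; rewrite mem_head.
by exists (enum_val (Ordinal lt) :: u); rewrite /= ux /rank enum_valK.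
Qed.

(** A number that is no state reads the default table entry, which has no successors, so the
    validity test itself rejects it. *)
Lemma lasso_valid_states (x y : seq nat) : lasso_valid kripke_table x y ->
  exists u s v, x = map rank u /\ y = map rank (s :: v).
Proof.
case/andP => y0 /all_belowP h.
have lt : {in x ++ y, forall a, a < #|state K|}.
  move=> a /(nthP 0)[i]; rewrite size_cat => hi <-; have := h i hi.
  rewrite /lasso_state (lasso_position_id y0 hi) -size_kripke_table ltnNge.
  by apply: contraTN => hs; rewrite (nth_default _ hs).
have [|u hu] := @rank_surj x; first by move=> a ax; apply: lt; rewrite mem_cat ax.
have [|[|s v] hv] := @rank_surj y; first by move=> a ay; apply: lt; rewrite mem_cat ay orbT.
  by rewrite -hv in y0.
by exists u, s, v.
Qed.

Lemma lasso_valueE O n u s v c :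
  lasso_value O n kripke_table (map rank u) (map rank (s :: v)) c =
  values O n (codes_of_labels (trace (lasso u s v))) c 0.
Proof.
rewrite /lasso_value; set lab := fun i => _.
have -> : lab = codes_of_labels (trace (lasso u s v)).
  by apply: funext => i; rewrite /lab lasso_stateE nth_kripke_table.
rewrite lasso_tableE; [by rewrite nth_mkseq ?addn_gt0 ?orbT| by [] |].
move=> i; rewrite /codes_of_labels /trace; congr [seq _ | p <- enum (label _)].
by apply: rank_inj; rewrite -!lasso_stateE lasso_state_position.
Qed.

Lemma code_bound_mono N m m' : m <= m' -> code_bound N m <= code_bound N m'.
Proof.
move/subnKC <-; elim: (m' - m) => [|k IH]; first by rewrite addn0.
rewrite addnS /=; apply: leq_trans IH _; apply: leqW.
by apply: leq_trans (leq_pair_code _ _); exact: leq_addl.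
Qed.

Lemma states_code_bound u : states_code u <= code_bound #|state K| (size u).
Proof.
rewrite /states_code; elim: u => //= s u IH; rewrite ltnS.
by apply: pair_code_mono => //; exact/ltnW/ltn_ord.
Qed.

Lemma exists_path : exists xi, is_path (K := K) xi.
Proof.
have /card_gt0P[s0 _] := state_nonempty K.
have [f hf] := choice (@trans_total AP K).
by exists (fun i => iter i f s0) => i; exact: hf.
Qed.

Lemma states_code_lasso_bound n c u :
  size u <= (type_bound #|state K| n c).+1 * (type_bound #|state K| n c).+1 ->
  states_code u <= lasso_bound #|state K| n c.
Proof.
move=> hu; apply: leq_trans (states_code_bound u) _; apply: code_bound_mono.
by apply: leq_trans hu _; apply: leq_mul.
Qed.

(* The finitely many lassos whose codes are below [lasso_bound] realise all the
   values that paths of [K] take at precision [n]. *)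
Lemma lasso_values_cover O n c xi : is_path (K := K) xi -> exists u s v,
  [/\ is_path (lasso u s v), states_code u <= lasso_bound #|state K| n c,
      states_code (s :: v) <= lasso_bound #|state K| n c
    & lasso_value O n kripke_table (map rank u) (map rank (s :: v)) c =
      values O n (codes_of_labels (trace xi)) c 0].
Proof.
move=> /(bounded_lasso O n c)[u [s [v [h1 h2 h3 h4]]]]; exists u, s, v; split.
- exact: h1.
- by apply: states_code_lasso_bound; apply: leq_trans h3 _; rewrite mulSn; exact: leq_trans (leqnSn _) (leq_addr _ _).
- exact: (states_code_lasso_bound h4).
- by rewrite lasso_valueE; exact: h2.
Qed.

End LassoCodes.

(* As for [values], to keep conversion from computing. *)
Opaque lasso_bound lasso_value.

Section Search.
Variables (R : realType) (AP : finType).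
Variables (D : set (nat -> R)) (F : forall k : nat, set ('rV[R]_k -> R)).
Hypothesis hD : forall eta : nat -> R, D eta -> discounting eta.
Hypothesis hF : forall k : nat, @F k `<=` @Fmc R k.
Variables (K : kripke AP) (phi : formula AP D F) (eps : R).
Variables (O : nat -> nat) (cphi ceps : nat).
Hypothesis eps0 : 0 < eps.
Hypothesis hphi : codes_formula O phi cphi.
Hypothesis heps : names_real (channel O ceps) eps.
Let input := [:: kripke_code K; cphi; ceps].

Lemma truth_bounds0 n pi :
  bounds (2 ^ n) (values O n (codes_of_labels pi) cphi 0) (truth pi phi).
Proof. exact: (truth_bounds hD hF hphi n pi 0). Qed.

Lemma acceptsP n a b : accepts O input (pair_code n (pair_code a b)) <->
  [/\ lasso_valid (kripke_table K) (unseq a) (unseq b)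
    & forall u s v, is_path (lasso u s v) ->
        (states_code u <= lasso_bound #|state K| n cphi)%N ->
        (states_code (s :: v) <= lasso_bound #|state K| n cphi)%N ->
        ((lasso_value O n (kripke_table K) (map (@rank _ K) u) (map (@rank _ K) (s :: v)) cphi).2 <
        (lasso_value O n (kripke_table K) (unseq a) (unseq b) cphi).1 + O (pair_code ceps n))%N].
Proof.
rewrite /accepts; cbv zeta; rewrite !pair_codeK.
cbn [fst snd nth input]; rewrite kripke_dataE size_kripke_table; split.
  case/andP => h1 /all_belowP h2; split=> // u s v p hu hv.
  have /all_belowP h3 := h2 (states_code u) hu; have := h3 (states_code (s :: v)) hv.
  by rewrite /states_code !seq_codeK => /implyP; apply; apply/lasso_validE.
case=> h1 h2; rewrite h1; apply/all_belowP => a' ha; apply/all_belowP => b' hb; apply/implyP => hv.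
have [u [s [v [eu ev]]]] := lasso_valid_states hv.
rewrite eu ev; apply: h2; first by apply/lasso_validE; rewrite -eu -ev.
  by rewrite /states_code -/(map (@rank _ K) u) -eu unseqK.
by rewrite /states_code -/(map (@rank _ K) (s :: v)) -ev unseqK.
Qed.

(** For any path, some bounded lasso has the same upper bound at this precision; the test against
    bounded lassos therefore bounds the value of every path, hence the supremum. *)
Lemma accepted_near_optimal m : accepts O input m ->
  exists (u : seq (state K)) (s : state K) (v : seq (state K)),
  (unpair m).2 = pair_code (states_code u) (states_code (s :: v)) /\
  near_optimal phi eps (lasso u s v).
Proof.
rewrite -{1}(unpairK m) -{1}(unpairK (unpair m).2) => /acceptsP.
move: (unpair m).1 (unpair (unpair m).2) (unpairK (unpair m).2) => n [a b] /= em [hv hopt].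
have [u [s [v [eu ev]]]] := lasso_valid_states hv.
exists u, s, v; split.
  by rewrite -em -(unseqK a) -(unseqK b) eu ev.
have hp : is_path (lasso u s v) by apply/lasso_validE; rewrite -eu -ev.
split=> //; rewrite lerBlDr; apply: ge_sup.
  by exists (truth (trace (lasso u s v)) phi); exists (lasso u s v).
move=> _ [xi pxi <-].
have [u' [s' [v' [p' b1 b2 e']]]] := lasso_values_cover O n cphi pxi.
have := hopt u' s' v' p' b1 b2; rewrite e' eu ev lasso_valueE.
have /andP[_ h1] := truth_bounds0 n (trace xi).
have /andP[h2 _] := truth_bounds0 n (trace (lasso u s v)).
move: h1 h2; move: (values _ _ _ _ _).2 (values _ _ _ _ _).1 => H L h1 h2 lt.
have S0 : 0 < (2 ^ n)%N%:R :> R by rewrite ltr0n expn_gt0.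
have := names_real_scaled n heps; rewrite ler_distl => /andP[_ h3].
rewrite -(ler_pM2l S0) mulrDr; apply: le_trans h1 _.
(* The unit gained from strictness cancels the error of the oracle's answer for eps. *)
have : (H.+1)%:R <= L%:R + (O (pair_code ceps n))%:R :> R by rewrite -natrD ler_nat.
move: h3; rewrite /channel -natr1; lra.
Qed.

(** A bounded lasso of greatest upper bound is accepted. Its gap is at most a quarter of eps at the
    scale, while the oracle's answer is at least eps at the scale minus 1; scale times eps being at
    least 8 leaves the strict inequality. *)
Lemma exists_accepted : exists m, accepts O input m.
Proof.
have e4 : 0 < eps / 4 by rewrite divr_gt0.
have [N1 hN1] := values_converge hD hF hphi e4.
have [N2 hN2] := eventually_leq_expn2 (8 / eps).
pose n := maxn N1 N2.
have hgap := hN1 n (leq_maxl _ _); have := hN2 n (leq_maxr _ _).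
move: n hgap => n hgap; rewrite ler_pdivrMr // => hn.
pose C := lasso_bound #|state K| n cphi.
pose val u s v := lasso_value O n (kripke_table K) (map (@rank _ K) u) (map (@rank _ K) (s :: v)) cphi.
pose P h := `[< exists u s v, [/\ is_path (lasso u s v), (states_code u <= C)%N,
  (states_code (s :: v) <= C)%N & (val u s v).2 = h] >].
have exP : exists h, P h.
  have [xi pxi] := exists_path K.
  have [u [s [v [p b1 b2 _]]]] := lasso_values_cover O n cphi pxi.
  by exists (val u s v).2; apply/asboolP; exists u, s, v.
have ubP h : P h -> (h <= 2 ^ n)%N.
  case/asboolP => u [s [v [_ _ _ <-]]]; rewrite /val lasso_valueE.
  by have /andP[] := values_leq O n (codes_of_labels (trace (lasso u s v))) cphi 0.
case: (ex_maxnP exP ubP) => h /asboolP[u [s [v [p b1 b2 eh]]]] hmax.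
exists (pair_code n (pair_code (states_code u) (states_code (s :: v)))).
apply/acceptsP; rewrite /states_code !seq_codeK; split; first exact/lasso_validE.
move=> u' s' v' p' b1' b2'.
have hle : ((val u' s' v').2 <= (val u s v).2)%N.
  by rewrite eh; apply: hmax; apply/asboolP; exists u', s', v'.
apply: leq_ltn_trans hle _; rewrite /val lasso_valueE.
rewrite -(ltr_nat R) natrD; apply: le_lt_trans (hgap _ _) _.
rewrite ltrD2l.
have := names_real_scaled n heps; rewrite ler_distl /channel => /andP[h3 _].
move: hn h3; have -> : eps / 4 * (2 ^ n)%N%:R = (2 ^ n)%N%:R * eps / 4 by field.
move: ((2 ^ n)%N%:R * eps) => X; lra.
Qed.

End Search.

Lemma computable_rejects :
  computable (fun O (z : seq nat * nat) => if accepts O z.1 z.2 then 0%N else 1%N).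
Proof. by apply: computable_if; [exact: computable_accepts | |]; computability. Qed.

Unset Implicit Arguments.

Theorem theorem4p14 (R : realType) (AP : finType)
    (D : set (nat -> R)) (F : forall k : nat, set ('rV[R]_k -> R))
    (hD : forall eta : nat -> R, D eta -> discounting eta)
    (hF : forall k : nat, F k `<=` @Fmc R k) :
  exists P : program,
    forall (K : kripke AP) (phi : formula AP D F) (eps : R),
      0 < eps < 1 ->
    forall (O : nat -> nat) (cphi ceps : nat),
      codes_formula O phi cphi -> names_real (channel O ceps) eps ->
    exists (u : seq (state K)) (s : state K) (v : seq (state K)),
      run O P (seq_code [:: kripke_code K; cphi; ceps])
              (pair_code (states_code u) (states_code (s :: v))) /\
      near_optimal phi eps (lasso u s v).
Proof.
have [p hp] := computable_rejects.
(* [PMu] finds the least accepted number; [PSnd] discards the precision packed in it and keeps the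
   lasso. *)
exists (PComp PSnd (PMu p)) => K phi eps /andP[eps0 _] O cphi ceps hphi heps.
have ex := exists_accepted hD hF K eps0 hphi heps.
case: (ex_minnP ex) => m hm hmin.
have [u [s [v [em opt]]]] := accepted_near_optimal hD hF hphi heps hm.
exists u, s, v; split=> //.
have run_p i : run O p (pair_code (seq_code [:: kripke_code K; cphi; ceps]) i)
    (if accepts O [:: kripke_code K; cphi; ceps] i then 0 else 1)%N.
  exact: (hp O ([:: kripke_code K; cphi; ceps], i)).
(* Rejection is the output 1, the successor of the constant witness 0, as [run_mu] requires before
   the first zero. *)
apply: run_comp (run_mu (n := m) (w := fun=> 0%N) _ _) _.
- move=> i im; have := run_p i; case: ifP => // hi _.
  by have := hmin i hi; rewrite leqNgt im.
- by have := run_p m; rewrite hm; apply.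
- by rewrite -{1}(unpairK m) em; exact: run_snd.
Qed.
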